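(* Let $G=(V,E)$ be a graph and let $(\{V_i\}_{i=1}^{d+1},\{E_{ij}\}_{1\le i<j\le d+1})$ be a $d$-rigid partition of $G$. For $1\le i<j\le d+1$ let $G_{ij}=(V_i\cup V_j,E_{ij})$. Then \[\mathsf a_d(G)\ge\min\left\{\frac{\mathsf a(G_{ij})}{2}:1\le i<j\le d+1\right\}.\] In particular $G$ is $d$-rigid.
   Context: Assume $|V|\ge d+1$. For an injective embedding $\mathbf p:V\to\mathbb R^d$ and $u\ne v$, let $d_{uv}(\mathbf p)=(\mathbf p(u)-\mathbf p(v))/\|\mathbf p(u)-\mathbf p(v)\|$. The normalized rigidity matrix $\hat{\mathsf R}(G,\mathbf p)\in\mathbb R^{d|V|\times|E|}$ has columns indexed by edges; the column of $\{u,v\}$ equals $d_{uv}(\mathbf p)$ in the $d$ coordinates of $u$, $d_{vu}(\mathbf p)$ in those of $v$, and $0$ elsewhere. The stiffness matrix is $\mathsf L(G,\mathbf p)=\hat{\mathsf R}(G,\mathbf p)\hat{\mathsf R}(G,\mathbf p)^{\mathsf T}$. With $\lambda_k(M)$ the $k$-th smallest eigenvalue, the $d$-dimensional algebraic connectivity is $\mathsf a_d(G)=\sup_{\mathbf p}\lambda_{\binom{d+1}{2}+1}(\mathsf L(G,\mathbf p))$. For $d=1$ this is the usual algebraic connectivity $\mathsf a(G)=\lambda_2$ of the graph Laplacian, with the convention $\mathsf a(G)=\infty$ for the one-vertex graph. $G$ is $d$-rigid iff $\mathsf a_d(G)>0$, equivalently iff some embedding's rigidity matrix has rank $d|V|-\binom{d+1}2$.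 A $d$-rigid partition: $V_1,\dots,V_{d+1}$ are pairwise disjoint with union $V$ (empty sets allowed), $\{E_{ij}\}_{1\le i<j\le d+1}$ are pairwise disjoint subsets of $E$ with every $e\in E_{ij}$ satisfying $e\subseteq V_i\cup V_j$, each $G_{ij}$ is connected (a graph with no vertices counts as disconnected), and for every $i$ and every $U\subseteq V_i$ with $|U|\ge2$ there is a partition $U=U'\cup U''$ into nonempty sets such that all edges of $\hat E=\bigcup E_{ij}$ with one endpoint in $U'$ and the other in $U''$ lie in a single class $E_{i'j'}$. *)

(* Defs.v *)
From HB Require Import structures.
From mathcomp Require Import all_boot all_order all_algebra.
From mathcomp Require Import all_classical all_reals all_analysis.

Set Implicit Arguments.
Unset Strict Implicit.
Unset Printing Implicit Defensive.

Import Order.TTheory GRing.Theory Num.Theory.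

Local Open Scope ring_scope.

(* A finite simple graph on V is given by its set E of edges, each edge being
   a two-element set of vertices. *)
Definition simple_graph (V : finType) (E : {set {set V}}) : Prop :=
  forall e, e \in E -> #|e| = 2%N.

Definition adj (V : finType) (F : {set {set V}}) : rel V :=
  fun u v => [set u; v] \in F.

(* Connectedness of the graph (W, F), where every edge of F is contained in W
   (so that paths between vertices of W stay in W). *)
Definition graph_connected (V : finType) (W : {set V}) (F : {set {set V}}) :
    Prop :=
  W != finset.set0 /\ forall u v, u \in W -> v \in W -> connect (adj F) u v.

(* The nondecreasing list of the real eigenvalues of M with algebraic
   multiplicity. It exists, and is unique, as soon as the characteristic
   polynomial splits over R, in particular for every symmetric M. *)
Definition eigenvalues (R : realType) (n : nat) (M : 'M[R]_n) : seq R :=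
  xget [::] [set s : seq R | sorted <=%R s /\
                             char_poly M = \prod_(a <- s) ('X - a%:P)]%classic.

(* The k-th smallest eigenvalue, counting from k = 1. *)
Definition lambda (R : realType) (k n : nat) (M : 'M[R]_n) : R :=
  (eigenvalues M)`_(k.-1).

(* The library norm on 'rV[R]_d is the sup norm. *)
Definition enorm (R : realType) (d : nat) (x : 'rV[R]_d) : R :=
  Num.sqrt (\sum_(k < d) x ord0 k ^+ 2).

Definition direction (R : realType) (V : finType) (d : nat)
    (p : V -> 'rV[R]_d) (u v : V) : 'rV[R]_d :=
  (enorm (p u - p v))^-1 *: (p u - p v).

(* The normalized rigidity matrix. Rows are indexed by V * 'I_d and columns by E. For e = {u, v} and w = u, the
   sum below has the single term x = v. *)
Definition rigidity_mx (R : realType) (V : finType) (d : nat)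
    (E : {set {set V}}) (p : V -> 'rV[R]_d) :
    'M[R]_(#|{: V * 'I_d}|, #|E|) :=
  \matrix_(r < #|{: V * 'I_d}|, c < #|E|)
    let: (w, k) := enum_val r in
    let e : {set V} := enum_val c in
    if w \in e then \sum_(x in e :\ w) direction p w x ord0 k else 0.

Definition stiffness_mx (R : realType) (V : finType) (d : nat)
    (E : {set {set V}}) (p : V -> 'rV[R]_d) : 'M[R]_(#|{: V * 'I_d}|) :=
  rigidity_mx E p *m (rigidity_mx E p)^T.

Definition alg_connectivity_dim (R : realType) (V : finType) (d : nat)
    (E : {set {set V}}) : \bar R :=
  ereal_sup [set (lambda ('C(d.+1, 2)).+1 (stiffness_mx E p))%:E
            | p in [set p : V -> 'rV[R]_d | injective p]]%classic.

(* Normalization scales the columns of the usual rigidity matrix by nonzero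
   factors, hence does not change its rank. *)
Definition d_rigid (R : realType) (V : finType) (d : nat)
    (E : {set {set V}}) : Prop :=
  exists2 p : V -> 'rV[R]_d, injective p &
    \rank (rigidity_mx E p) = (d * #|V| - 'C(d.+1, 2))%N.

(* Laplacian of the graph (W, F), with F a set of edges contained in W. *)
Definition laplacian (R : realType) (V : finType) (W : {set V})
    (F : {set {set V}}) : 'M[R]_(#|W|) :=
  \matrix_(r < #|W|, c < #|W|)
    if r == c then #|[set e in F | enum_val r \in e]|%:R
    else - (adj F (enum_val r) (enum_val c))%:R.

Definition alg_connectivity (R : realType) (V : finType) (W : {set V})
    (F : {set {set V}}) : \bar R :=
  if #|W| == 1%N then +oo%E else (lambda 2 (laplacian R W F))%:E.

(* Only the values EP i j with i < j are meaningful. *)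
Definition part_edges (V : finType) (d : nat)
    (EP : 'I_d.+1 -> 'I_d.+1 -> {set {set V}}) : {set {set V}} :=
  \bigcup_(ij : 'I_d.+1 * 'I_d.+1 | (ij.1 < ij.2)%N) EP ij.1 ij.2.

Record rigid_partition (V : finType) (d : nat) (E : {set {set V}})
    (VP : 'I_d.+1 -> {set V}) (EP : 'I_d.+1 -> 'I_d.+1 -> {set {set V}}) :
    Prop := RigidPartition {
  rp_disjoint_V : forall i j, i != j -> [disjoint VP i & VP j];
  rp_cover_V : \bigcup_(i < d.+1) VP i = [set: V];
  rp_sub_E : forall i j : 'I_d.+1, (i < j)%N -> EP i j \subset E;
  rp_disjoint_E : forall i j k l : 'I_d.+1, (i < j)%N -> (k < l)%N ->
    (i, j) != (k, l) -> [disjoint EP i j & EP k l];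
  rp_ends : forall (i j : 'I_d.+1) (e : {set V}), (i < j)%N -> e \in EP i j ->
    e \subset VP i :|: VP j;
  rp_connected : forall i j : 'I_d.+1, (i < j)%N ->
    graph_connected (VP i :|: VP j) (EP i j);
  rp_split : forall (i : 'I_d.+1) (U : {set V}), U \subset VP i ->
    (2 <= #|U|)%N ->
    exists U1 U2 : {set V},
      [/\ U1 :|: U2 = U, [disjoint U1 & U2], U1 != finset.set0,
          U2 != finset.set0 &
          exists i' j' : 'I_d.+1, (i' < j')%N /\
            forall u v, u \in U1 -> v \in U2 ->
              [set u; v] \in part_edges EP -> [set u; v] \in EP i' j']
}.

(* Main.v *)
Require Import Defs.
From HB Require Import structures.
From mathcomp Require Import all_boot all_order all_algebra.
From mathcomp Require Import all_classical all_reals all_analysis.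
From mathcomp Require Import perm ring lra zify complex.

Set Implicit Arguments.
Unset Strict Implicit.
Unset Printing Implicit Defensive.

Import Order.TTheory GRing.Theory Num.Theory numFieldNormedType.Exports.

Local Open Scope ring_scope.

(* Put the part V_i at the vertex x_i of a regular simplex and separate the
   vertices of V_i along the recursive splittings, each time by a displacement
   of a smaller order in t whose direction is that of the class crossing the
   split. As t -> 0, every edge of E_ij becomes parallel to x_i - x_j, so the
   stiffness matrix tends to one whose quadratic form dominates the sum over
   i < j of L(G_ij) applied to the components f . (x_i - x_j) / sqrt 2. On the
   subspace where, for all i < j, this component has mean zero over V_i u V_j
   (codimension at most C(d+1,2)), the Poincare inequality for the G_ij and the
   frame inequality sum_j (z . (x_i - x_j))^2 >= |z|^2 bound the form below by
   min a(G_ij) / 2, and Courant-Fischer concludes. For rigidity, the same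
   subspace bounds the rank of the rigidity matrix from below; the bound from
   above holds for every embedding, as the trivial motions of a generic
   perturbation show. *)

(** * Spectral theorem and Courant-Fischer for real symmetric matrices *)

Definition sqn (R : realType) (n : nat) (x : 'rV[R]_n) : R :=
  \sum_i x 0 i ^+ 2.

Definition qform (R : realType) (n : nat) (A : 'M[R]_n) (x : 'rV[R]_n) : R :=
  (x *m A *m x^T) 0 0.

Lemma mul_tr00 (R : realType) (n : nat) (x y : 'rV[R]_n) :
  (x *m y^T) 0 0 = \sum_i x 0 i * y 0 i.
Proof. by rewrite mxE; apply: eq_bigr => i _; rewrite mxE. Qed.

Lemma sqnE (R : realType) (n : nat) (x : 'rV[R]_n) : sqn x = (x *m x^T) 0 0.
Proof. by rewrite mul_tr00; apply: eq_bigr => i _; rewrite expr2. Qed.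

Lemma sqn_ge0 (R : realType) (n : nat) (x : 'rV[R]_n) : 0 <= sqn x.
Proof. by apply: sumr_ge0 => i _; exact: sqr_ge0. Qed.

Lemma sqn_eq0 (R : realType) (n : nat) (x : 'rV[R]_n) : (sqn x == 0) = (x == 0).
Proof.
apply/idP/eqP => [|->]; last by apply/eqP/big1 => i _; rewrite mxE expr0n.
rewrite psumr_eq0 => [/allP h|i _]; last exact: sqr_ge0.
apply/rowP => i; rewrite mxE; apply/eqP; rewrite -sqrf_eq0.
by apply: h; rewrite mem_index_enum.
Qed.

Lemma sqn_gt0 (R : realType) (n : nat) (x : 'rV[R]_n) : (0 < sqn x) = (x != 0).
Proof. by rewrite lt_def sqn_ge0 sqn_eq0 andbT. Qed.

Lemma sqn_orthogonal (R : realType) (m n : nat) (P : 'M[R]_(m, n)) (x : 'rV_m) :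
  P *m P^T = 1%:M -> sqn (x *m P) = sqn x.
Proof. by move=> PPt; rewrite !sqnE trmx_mul mulmxA -(mulmxA x) PPt mulmx1. Qed.

(* A non-real eigenvalue [a + i b] would make the positive definite matrix
   [(a - A)^2 + b^2] singular. *)
Lemma symmetric_eigenvector (R : realType) (n : nat) (A : 'M[R]_n.+1) :
  A^T = A -> exists a (v : 'rV_n.+1), v != 0 /\ v *m A = a *: v.
Proof.
move=> Asym.
pose f := real_complex R.
pose Ac := map_mx f A.
have /closed_rootP[z] : size (char_poly Ac) != 1%N by rewrite size_char_poly.
rewrite -eigenvalue_root_char => /eigenvalueP[u uA u0].
case: z uA => a b uA.
pose M := (a%:M - A) *m (a%:M - A) + (b ^+ 2)%:M.
have uM : u *m map_mx f M = 0.
  have e1 : u *m map_mx f (a%:M - A) = (- (Complex 0 b)) *: u.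
    rewrite map_mxB map_scalar_mx mulmxBr uA mul_mx_scalar -scalerBl.
    congr (_ *: _); apply/eqP; rewrite eq_complex /=.
    by rewrite !(oppr0, addr0, subrr, add0r) !eqxx.
  rewrite map_mxD map_mxM map_scalar_mx mulmxDr mulmxA e1 -scalemxAl e1.
  rewrite mul_mx_scalar scalerA -scalerDl.
  suff -> : - Complex 0 b * - Complex 0 b + f (b ^+ 2) = 0 by rewrite scale0r.
  apply/eqP; rewrite eq_complex /=; apply/andP; split; apply/eqP; ring.
have : \det (map_mx f M) == 0 by apply/det0P; exists u.
rewrite det_map_mx fmorph_eq0 => /det0P[v v0 vM].
have Mt : (a%:M - A)^T = a%:M - A by rewrite linearB /= tr_scalar_mx Asym.
(* The quadratic form of [M] at [v] is [|v (a - A)|^2 + b^2 |v|^2]; its vanishing forces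
   [v (a - A) = 0]. *)
have : (v *m M *m v^T) 0 0 = 0 by rewrite vM mul0mx mxE.
rewrite mulmxDr mulmxDl mxE mul_mx_scalar -scalemxAl [X in _ + X]mxE -sqnE.
rewrite -{2}Mt mulmxA -mulmxA -trmx_mul -sqnE => h.
have := sqn_ge0 (v *m (a%:M - A)).
have := sqn_ge0 v => s1 s2.
have s3 : 0 <= b ^+ 2 * sqn v by rewrite mulr_ge0 ?sqr_ge0.
have /eqP : sqn (v *m (a%:M - A)) = 0 by lra.
rewrite sqn_eq0 mulmxBr mul_mx_scalar subr_eq0 eq_sym => /eqP vA.
by exists a, v.
Qed.

Lemma sqnZ (R : realType) (n : nat) a (x : 'rV[R]_n) : sqn (a *: x) = a ^+ 2 * sqn x.
Proof. by rewrite /sqn mulr_sumr; apply: eq_bigr => i _; rewrite mxE exprMn. Qed.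

(* Householder reflection exchanging the first basis vector and [v]. *)
Lemma orthogonal_completion (R : realType) (n : nat) (v : 'rV[R]_n.+1) :
  sqn v = 1 -> exists2 H : 'M[R]_n.+1, H *m H^T = 1%:M & row 0 H = v.
Proof.
move=> v1; pose e : 'rV[R]_n.+1 := delta_mx 0 0; pose w := e - v.
have [w0|w0] := eqVneq w 0.
  exists 1%:M; first by rewrite trmx1 mulmx1.
  by rewrite row1; apply/eqP; rewrite -subr_eq0; apply/eqP.
have s0 : sqn w != 0 by rewrite sqn_eq0.
pose c := 2 / sqn w; pose W := w^T *m w; pose H := 1%:M - c *: W.
have WW : W *m W = sqn w *: W.
  by rewrite /W mulmxA -(mulmxA w^T) [w *m _]mx11_scalar -sqnE mul_mx_scalar -scalemxAl.
have Ht : H^T = H by rewrite linearB linearZ /= trmx1 trmx_mul trmxK.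
exists H.
  have cc : c * (c * sqn w) = c + c by rewrite /c; field.
  rewrite Ht mulmxBl mul1mx mulmxBr mulmx1 -scalemxAl -scalemxAr WW !scalerA.
  by rewrite -mulrA cc scalerDl opprB addrK subrK.
rewrite rowE mulmxBr mulmx1 -scalemxAr mulmxA.
rewrite [_ *m w^T]mx11_scalar mul_scalar_mx scalerA.
rewrite -/e; have -> : (e *m w^T) 0 0 = 1 - v 0 ord0.
  by rewrite /e -rowE !mxE !eqxx.
(* As [e] and [v] are unit vectors, [|e - v|^2 = 2 (1 - v 0 0)]; the coefficient of [w] in [e H] is
   therefore 1 and [e H = e - w = v]. *)
have sw : sqn w = 2 * (1 - v 0 ord0).
  move: v1; rewrite /sqn !big_ord_recl !mxE /= => v1.
  under eq_bigr do rewrite !mxE /= sub0r sqrrN.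
  move: v1; set S := \sum_(i < n) _ => v1.
  have -> : S = 1 - v 0 ord0 ^+ 2 by rewrite -v1 addrAC subrr add0r.
  by ring.
rewrite (_ : c * _ = 1); first by rewrite scale1r /w opprB addrC subrK.
by rewrite /c sw; field; move: s0; rewrite sw mulf_eq0 negb_or => /andP[].
Qed.

(** Complete a unit eigenvector to an orthogonal basis; by symmetry the conjugated matrix splits off
    a 1 x 1 block, and induction treats the rest. *)
Lemma spectral_theorem (R : realType) (n : nat) (A : 'M[R]_n) : A^T = A ->
  exists (P : 'M[R]_n) (s : 'rV_n), P *m P^T = 1%:M /\ P *m A *m P^T = diag_mx s.
Proof.
elim: n A => [|n IHn] A Asym.
  by exists 1%:M, 0; split; apply/matrixP; case.
have [a [v [v0 vA]]] := symmetric_eigenvector Asym.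
have sv : 0 < sqn v by rewrite sqn_gt0.
pose u := (Num.sqrt (sqn v))^-1 *: v.
have u1 : sqn u = 1.
  by rewrite sqnZ exprVn sqr_sqrtr ?ltW// mulVf// gt_eqF.
have [H HHt rH] := orthogonal_completion u1.
have uA : u *m A = a *: u by rewrite -scalemxAl vA !scalerA mulrC.
pose B : 'M[R]_(1 + n) := H *m A *m H^T.
have Bsym : B^T = B by rewrite /B !trmx_mul trmxK Asym mulmxA.
have B0 : row 0 B = a *: delta_mx 0 0.
  rewrite /B !row_mul rH uA -rH -scalemxAl -row_mul HHt; congr (_ *: _).
  exact: row1.
have Bur : ursubmx B = 0.
  apply/matrixP => i j; rewrite ord1 !mxE.
  by move/rowP/(_ (rshift 1 j)): B0; rewrite !mxE lshift0 mulr0.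
have Bdl : dlsubmx B = 0 by rewrite -Bsym -trmx_ursub Bur trmx0.
have Bdr : (drsubmx B)^T = drsubmx B by rewrite trmx_drsub Bsym.
have [Q [s [QQt QB]]] := IHn _ Bdr.
pose K : 'M[R]_(1 + n) := block_mx 1%:M 0 0 Q.
have KK : K *m K^T = 1%:M.
  rewrite tr_block_mx mulmx_block !(mul0mx, mulmx0, addr0, add0r, trmx0, trmx1, mulmx1).
  by rewrite QQt -scalar_mx_block.
have KB : K *m B *m K^T = diag_mx (row_mx (ulsubmx B) s).
  rewrite -[in LHS](submxK B) Bur Bdl tr_block_mx !mulmx_block.
  rewrite !(mul0mx, mulmx0, addr0, add0r, trmx0, trmx1, mulmx1, mul1mx) QB diag_mx_row.
  by congr block_mx; apply/matrixP => i j; rewrite !ord1 !mxE eqxx.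
exists (K *m H), (row_mx (ulsubmx B) s); rewrite trmx_mul; split.
  by rewrite mulmxA -(mulmxA _ H) HHt mulmx1 KK.
by rewrite !mulmxA -2!(mulmxA K) KB.
Qed.

Lemma char_poly_conj (R : realType) (n : nat) (P A : 'M[R]_n) :
  P *m P^T = 1%:M -> char_poly (P *m A *m P^T) = char_poly A.
Proof.
move=> PPt; pose Q := map_mx polyC P; pose Q' := map_mx polyC P^T.
have QQ : Q *m Q' = 1%:M by rewrite -map_mxM PPt map_mx1.
have -> : char_poly (P *m A *m P^T) = \det (Q *m char_poly_mx A *m Q').
  rewrite /char_poly /char_poly_mx mulmxBr mulmxBl !map_mxM.
  by rewrite scalar_mxC -(mulmxA 'X%:M) QQ mulmx1.
by rewrite !det_mulmx mulrAC -det_mulmx QQ det1 mul1r.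
Qed.

(** The sorted diagonal entries from the spectral theorem meet the specification, so [xget] does not
    fall back to the empty list. *)
Lemma eigenvalues_spec (R : realType) (n : nat) (A : 'M[R]_n) : A^T = A ->
  sorted <=%R (eigenvalues A) /\
  char_poly A = \prod_(a <- eigenvalues A) ('X - a%:P).
Proof.
move=> Asym; rewrite /eigenvalues.
case: xgetP => [? -> []//|/(_ (sort <=%R [seq a | a <- _])) noeig].
have [P [s [PPt PA]]] := spectral_theorem Asym.
case: (noeig [seq s 0 i | i <- enum 'I_n]); rewrite map_id.
split; first exact/sort_sorted/le_total.
rewrite -(char_poly_conj _ PPt) PA char_poly_trig ?diag_mx_is_trig//.
rewrite (perm_big [seq s 0 i | i <- enum 'I_n]) /=; last by rewrite perm_sort.
by rewrite big_map enumT; apply: eq_bigr => i _; rewrite mxE eqxx.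
Qed.

Lemma size_eigenvalues (R : realType) (n : nat) (A : 'M[R]_n) : A^T = A ->
  size (eigenvalues A) = n.
Proof.
move=> /eigenvalues_spec[_ /(congr1 (fun p : {poly R} => size p))].
by rewrite size_char_poly size_prod_XsubC => -[].
Qed.

Lemma eigenvalues_le (R : realType) (n : nat) (A : 'M[R]_n) (i j : nat) :
  A^T = A -> (i <= j < n)%N -> (eigenvalues A)`_i <= (eigenvalues A)`_j.
Proof.
move=> Asym /andP[ij jn]; have [srt _] := eigenvalues_spec Asym.
apply: (sorted_leq_nth le_trans le_refl) => //; rewrite inE size_eigenvalues//.
exact: leq_ltn_trans jn.
Qed.

(** Two factorizations of the characteristic polynomial into linear factors agree up to a
    permutation, whose matrix is absorbed into [P]. *)
Lemma eigenvalues_diag (R : realType) (n : nat) (A : 'M[R]_n) : A^T = A ->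
  exists2 P : 'M[R]_n, P *m P^T = 1%:M &
    P *m A *m P^T = diag_mx (\row_i (eigenvalues A)`_i).
Proof.
move=> Asym; have [P [s [PPt PA]]] := spectral_theorem Asym.
have [_ chA] := eigenvalues_spec Asym.
have : perm_eq (eigenvalues A) [tuple s 0 i | i < n].
  apply: prod_XsubC_eq; rewrite -chA -(char_poly_conj _ PPt) PA.
  rewrite char_poly_trig ?diag_mx_is_trig// big_tuple.
  by apply: eq_bigr => i _; rewrite tnth_mktuple mxE eqxx.
case/tuple_permP => p eA.
have KK : perm_mx p *m (perm_mx p)^T = 1%:M :> 'M[R]_n.
  by rewrite tr_perm_mx -perm_mxM fingroup.mulgV perm_mx1.
exists (perm_mx p *m P).
  by rewrite trmx_mul mulmxA -(mulmxA _ P) PPt mulmx1.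
rewrite trmx_mul !mulmxA -2!(mulmxA (perm_mx p)) PA.
apply/matrixP => i j; rewrite tr_perm_mx -row_permE -col_permE !mxE.
rewrite (inj_eq perm_inj) eA.
by rewrite -tnth_nth !tnth_mktuple.
Qed.

Lemma qform_diag (R : realType) (n : nat) (A P : 'M[R]_n) (s y : 'rV_n) :
  P *m A *m P^T = diag_mx s ->
  qform A (y *m P) = \sum_i s 0 i * y 0 i ^+ 2.
Proof.
move=> PA; rewrite /qform trmx_mul mulmxA -(mulmxA y) -(mulmxA y) PA.
rewrite mul_tr00; apply: eq_bigr => i _; rewrite mul_mx_diag mxE; ring.
Qed.

(* Courant-Fischer: the span of the first k + 1 eigenvectors meets the
   subspace [x *m C = 0], which has codimension at most k. *)
Lemma lambda_ge (R : realType) (n k : nat) (A : 'M[R]_n) (C : 'M[R]_(n, k)) c :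
  A^T = A -> (k < n)%N ->
  (forall x, x *m C = 0 -> c * sqn x <= qform A x) -> c <= lambda k.+1 A.
Proof.
move=> Asym kn hc; have [P PPt PA] := eigenvalues_diag Asym.
pose J : 'M[R]_(k.+1, n) := pid_mx k.+1.
have JJ : J *m J^T = 1%:M.
  by rewrite tr_pid_mx mul_pid_mx; apply: etrans (pid_mx_1 _ _); congr pid_mx; lia.
(* A map from dimension [k.+1] to dimension [k] kills some nonzero [z], the coordinates of the test
   vector in the first [k.+1] eigenvectors. *)
have /rowV0Pn[z /sub_kermxP zker z0] : kermx (J *m P *m C) != 0.
  rewrite kermx_eq0 /row_free; apply/negP => /eqP rk.
  by have := rank_leq_col (J *m P *m C); rewrite rk ltnn.
pose y := z *m J; pose x := y *m P.
have xC : x *m C = 0 by rewrite -[RHS]zker /x /y !mulmxA.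
have sx : sqn x = sqn z by rewrite /x /y !sqn_orthogonal.
have sy : sqn y = sqn z by rewrite /y sqn_orthogonal.
have sz : 0 < sqn z by rewrite sqn_gt0.
rewrite -(ler_pM2r sz) -{1}sx.
apply: le_trans (hc _ xC) _; rewrite /x (qform_diag _ PA) -sy mulr_sumr.
apply: ler_sum => i _; rewrite mxE.
(* Up to index [k] the eigenvalue is at most the one at index [k], which is [lambda k.+1]; beyond it
   the coordinate of [y] vanishes. *)
have [ik|ki] := leqP i k.
  by rewrite ler_wpM2r ?sqr_ge0//; apply: eigenvalues_le => //; rewrite ik.
suff -> : y 0 i = 0 by rewrite expr0n !mulr0.
rewrite mxE big1 // => j _; rewrite mxE.
by have := ltn_ord j; case: eqP => [->|_]; rewrite ?mulr0 //= => ?; lia.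
Qed.

(** In an orthonormal eigenbasis the constant vector has only its first coordinate nonzero, since
    the other eigenvalues are positive. A vector orthogonal to it involves only the eigenvalues from
    the second on. *)
Lemma lambda2_spec (R : realType) (n : nat) (A : 'M[R]_n) :
  A^T = A -> (1 < n)%N -> (forall x, 0 <= qform A x) ->
  const_mx 1 *m A = 0 :> 'rV_n ->
  (forall x : 'rV_n, x *m A = 0 -> exists a, x = const_mx a) ->
  0 < lambda 2 A /\
  forall x : 'rV_n, x *m (const_mx 1)^T = 0 :> 'M[R]_1 ->
    lambda 2 A * sqn x <= qform A x.
Proof.
move=> Asym n1 psd A1 kerA.
have [P PPt PA] := eigenvalues_diag Asym.
have PtP : P^T *m P = 1%:M by apply: mulmx1C.
have n0 := ltnW n1; pose i0 := Ordinal n0; pose i1 := Ordinal n1.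
pose s i := (eigenvalues A)`_i.
have rowA i : row i P *m A = s i *: row i P.
  have : P *m A = diag_mx (\row_i (eigenvalues A)`_i) *m P.
    by rewrite -PA -mulmxA PtP mulmx1.
  move/(congr1 (row i)); rewrite row_mul => ->.
  by rewrite row_mul row_diag_mx -scalemxAl -rowE mxE.
have rowrow i j : (row i P *m (row j P)^T) 0 0 = (i == j)%:R.
  rewrite mul_tr00; move/matrixP/(_ i j): PPt; rewrite !mxE => <-.
  by apply: eq_bigr => k _; rewrite !mxE.
have s_ge0 (i : 'I_n) : 0 <= s i.
  have := psd (row i P); rewrite /qform rowA -scalemxAl mxE rowrow eqxx.
  by rewrite mulr1.
(* Otherwise the first two eigenvalues vanish, and two orthonormal eigenvectors would both be
   constant. *)
have s1 : 0 < s 1%N.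
  rewrite lt_def (s_ge0 i1) andbT; apply/negP => /eqP s10.
  have s00 : s 0%N = 0.
    apply: le_anti; rewrite (s_ge0 i0) andbT -s10.
    exact: eigenvalues_le.
  have [a ea] : exists a, row i0 P = const_mx a.
    by apply: kerA; rewrite rowA /= s00 scale0r.
  have [b eb] : exists b, row i1 P = const_mx b.
    by apply: kerA; rewrite rowA /= s10 scale0r.
  have := rowrow i0 i1; have := rowrow i0 i0; have := rowrow i1 i1.
  rewrite !mul_tr00 ea eb !eqxx.
  under eq_bigr do rewrite mxE; under [in X in _ -> X]eq_bigr do rewrite mxE.
  under [in X in _ -> _ -> X]eq_bigr do rewrite !mxE.
  rewrite !sumr_const => hb ha.
  have an0 : a != 0.
    apply/eqP => a0; move: ha; rewrite a0 mul0r mul0rn => /eqP.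
    by rewrite eq_sym oner_eq0.
  have bn0 : b != 0.
    apply/eqP => b0; move: hb; rewrite b0 mul0r mul0rn => /eqP.
    by rewrite eq_sym oner_eq0.
  move/eqP; rewrite mulrn_eq0 card_ord mulf_eq0 (negbTE an0) (negbTE bn0).
  by rewrite !orbF => /eqP nn; have := n1; rewrite nn.
split=> // x x1.
pose u : 'rV[R]_n := const_mx 1 *m P^T.
have us (i : 'I_n) : s i * u 0 i = 0.
  have : u *m (P *m A *m P^T) = 0.
    by rewrite /u !mulmxA -(mulmxA _ P^T) PtP mulmx1 A1 mul0mx.
  by rewrite PA mul_mx_diag => /rowP/(_ i); rewrite !mxE mulrC.
have u0 i : i != i0 -> u 0 i = 0.
  move=> ii; apply/eqP; have /eqP := us i; rewrite mulf_eq0 => /orP[|//].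
  suff : 0 < s i by move/gt_eqF->.
  apply: lt_le_trans s1 _; apply: eigenvalues_le => //.
  rewrite ltn_ord andbT lt0n; apply: contra ii => /eqP ii.
  exact/eqP/val_inj.
have un0 : u 0 i0 != 0.
  apply/eqP => ui0.
  have : u = 0.
    apply/rowP => i; rewrite [RHS]mxE.
    by have [->|/u0] := eqVneq i i0.
  move/(congr1 (mulmx^~ P)); rewrite /u mul0mx -mulmxA PtP mulmx1.
  by move/rowP/(_ i0); rewrite !mxE => /eqP; rewrite oner_eq0.
pose y := x *m P^T.
have xy : x = y *m P by rewrite /y -mulmxA PtP mulmx1.
have y0 : y 0 i0 = 0.
  have : (y *m u^T) 0 0 = 0.
    by rewrite /u /y trmx_mul trmxK mulmxA -(mulmxA x) PtP mulmx1 x1 mxE.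
  rewrite mul_tr00 (bigD1 i0) //= big1 ?addr0 => [|i /u0 ->]; last by rewrite mulr0.
  by move/eqP; rewrite mulf_eq0 (negbTE un0) orbF => /eqP.
rewrite xy sqn_orthogonal // (qform_diag _ PA) mulr_sumr.
apply: ler_sum => i _; have -> : (\row_k (eigenvalues A)`_k) 0 i = s i by rewrite mxE.
have [->|ii] := eqVneq i i0; first by rewrite y0 expr0n !mulr0.
rewrite ler_wpM2r ?sqr_ge0//; apply: eigenvalues_le => //.
rewrite ltn_ord andbT lt0n; apply: contra ii => /eqP ii.
exact/eqP/val_inj.
Qed.

(** * Quadratic forms of rigidity matrices and Laplacians *)

Definition dot (R : realType) (d : nat) (y z : 'rV[R]_d) : R :=
  \sum_k y 0 k * z 0 k.

Lemma dotBl (R : realType) (d : nat) (y y' z : 'rV[R]_d) :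
  dot (y - y') z = dot y z - dot y' z.
Proof. by rewrite /dot -sumrB; apply: eq_bigr => k _; rewrite !mxE mulrBl. Qed.

Lemma dotZr (R : realType) (d : nat) a (y z : 'rV[R]_d) :
  dot y (a *: z) = a * dot y z.
Proof. by rewrite /dot mulr_sumr; apply: eq_bigr => k _; rewrite !mxE mulrCA. Qed.

Lemma dotNr (R : realType) (d : nat) (y z : 'rV[R]_d) : dot y (- z) = - dot y z.
Proof. by rewrite -scaleN1r dotZr mulN1r. Qed.

(* The value at [v] of the vector field on [V] encoded by [x]. *)
Definition field_at (R : realType) (V : finType) (d : nat)
    (x : 'rV[R]_#|{: V * 'I_d}|) (v : V) : 'rV[R]_d :=
  \row_k x 0 (enum_rank (v, k)).

Lemma sum_enum_pair (R : realType) (V : finType) (d : nat)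
    (h : 'I_#|{: V * 'I_d}| -> R) :
  \sum_r h r = \sum_(v : V) \sum_(k < d) h (enum_rank (v, k)).
Proof.
rewrite pair_big /= (reindex (@enum_rank {: V * 'I_d})) /=.
  by apply: eq_bigr => -[].
by exists enum_val => i _; rewrite ?enum_rankK ?enum_valK.
Qed.

Lemma sqn_field (R : realType) (V : finType) (d : nat)
    (x : 'rV[R]_#|{: V * 'I_d}|) : sqn x = \sum_v sqn (field_at x v).
Proof.
rewrite /sqn sum_enum_pair; apply: eq_bigr => v _.
by apply: eq_bigr => k _; rewrite mxE.
Qed.

(** The free parameter [D] covers the normalized and the unnormalized rigidity matrix as well as the
    limit matrix. *)
Definition edge_mx (R : realType) (V : finType) (d : nat) (E : {set {set V}})
    (D : V -> V -> 'rV[R]_d) : 'M[R]_(#|{: V * 'I_d}|, #|E|) :=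
  \matrix_(r < #|{: V * 'I_d}|, c < #|E|)
    let: (w, k) := enum_val r in
    let e : {set V} := enum_val c in
    if w \in e then \sum_(x in e :\ w) D w x ord0 k else 0.

Lemma rigidity_edge_mx (R : realType) (V : finType) (d : nat)
    (E : {set {set V}}) (p : V -> 'rV[R]_d) :
  rigidity_mx E p = edge_mx E (direction p).
Proof. by []. Qed.

(** Summing over both ends avoids orienting the edge; for antisymmetric [D] this is the relative
    velocity of the ends along [D]. *)
Definition stretch (R : realType) (V : finType) (d : nat)
    (D : V -> V -> 'rV[R]_d) (x : 'rV[R]_#|{: V * 'I_d}|) (e : {set V}) : R :=
  \sum_(v in e) \sum_(w in e :\ v) dot (field_at x v) (D v w).

Lemma mul_edge_mx (R : realType) (V : finType) (d : nat) (E : {set {set V}})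
    (D : V -> V -> 'rV[R]_d) (x : 'rV[R]_#|{: V * 'I_d}|) (c : 'I_#|E|) :
  (x *m edge_mx E D) 0 c = stretch D x (enum_val c).
Proof.
rewrite mxE sum_enum_pair /stretch [RHS]big_mkcond /=; apply: eq_bigr => v _.
case: ifP => vc; last first.
  by apply: big1 => k _; rewrite mxE enum_rankK /= vc mulr0.
rewrite /dot exchange_big /=; apply: eq_bigr => k _.
rewrite !mxE enum_rankK /= vc mulr_sumr; by apply: eq_bigr => w _; rewrite ?mxE.
Qed.

Lemma qform_mul_tr (R : realType) (m n : nat) (M : 'M[R]_(m, n)) (x : 'rV_m) :
  qform (M *m M^T) x = sqn (x *m M).
Proof. by rewrite /qform sqnE trmx_mul !mulmxA. Qed.

Lemma sqn_edge_mx (R : realType) (V : finType) (d : nat) (E : {set {set V}})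
    (D : V -> V -> 'rV[R]_d) (x : 'rV[R]_#|{: V * 'I_d}|) :
  sqn (x *m edge_mx E D) = \sum_(e in E) stretch D x e ^+ 2.
Proof.
by rewrite [RHS]big_enum_val; apply: eq_bigr => c _; rewrite mul_edge_mx.
Qed.

Lemma sum_edge_ends (R : realType) (V : finType) (u v : V) (h : V -> V -> R) :
  u != v ->
  \sum_(a in [set u; v]) \sum_(b in [set u; v] :\ a) h a b = h u v + h v u.
Proof.
move=> uv; have set1U (a b : V) : a != b -> [set a; b] :\ a = [set b].
  move=> ab; apply/setP => z; rewrite !inE; case: eqVneq => //= ->.
  by rewrite (negbTE ab).
rewrite big_setU1 ?inE //= big_set1 set1U // big_set1.
by rewrite finset.setUC set1U 1?eq_sym // big_set1.
Qed.

Lemma stretch_pair (R : realType) (V : finType) (d : nat)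
    (D : V -> V -> 'rV[R]_d) (x : 'rV[R]_#|{: V * 'I_d}|) (u v : V) :
  (forall a b, D b a = - D a b) -> u != v ->
  stretch D x [set u; v] = dot (field_at x u - field_at x v) (D u v).
Proof.
by move=> Danti uv; rewrite /stretch sum_edge_ends // (Danti u v) dotNr dotBl.
Qed.

(** The square [(g u - g v)^2] split over its ends as [g u (g u - g v) + g v (g v - g u)]: no
    orientation is chosen, and these are the terms of the Laplacian form. *)
Definition edge_sqdiff (R : realType) (V : finType) (g : V -> R) (e : {set V}) : R :=
  \sum_(v in e) \sum_(w in e :\ v) g v * (g v - g w).

Lemma edge_sqdiff_pair (R : realType) (V : finType) (g : V -> R) (u v : V) :
  u != v -> edge_sqdiff g [set u; v] = (g u - g v) ^+ 2.
Proof. by move=> uv; rewrite /edge_sqdiff sum_edge_ends //; ring. Qed.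

Lemma edge_sqdiff_ge0 (R : realType) (V : finType) (g : V -> R) (e : {set V}) :
  #|e| = 2%N -> 0 <= edge_sqdiff g e.
Proof.
move/eqP/cards2P => [u [v [uv ->]]].
by rewrite edge_sqdiff_pair // sqr_ge0.
Qed.

Lemma adjC (V : finType) (F : {set {set V}}) (u v : V) : adj F u v = adj F v u.
Proof. by rewrite /adj finset.setUC. Qed.

(** A two-element edge containing distinct [v] and [w] is [[set v; w]], so an ordered adjacent pair
    arises from exactly one edge. *)
Lemma sum_edges_adj (R : realType) (V : finType) (F : {set {set V}})
    (h : V -> V -> R) : simple_graph F ->
  \sum_(e in F) \sum_(v in e) \sum_(w in e :\ v) h v w =
  \sum_v \sum_(w | w != v) (adj F v w)%:R * h v w.
Proof.
move=> F2.
under eq_bigr do rewrite big_mkcond /=.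
rewrite exchange_big /=; apply: eq_bigr => v _.
transitivity (\sum_(e in F) \sum_(w | w != v)
    ((v \in e) && (w \in e))%:R * h v w).
  apply: eq_bigr => e _; case: ifP => ve; last first.
    by apply/esym/big1 => w _; rewrite mul0r.
  rewrite big_mkcond [RHS]big_mkcond /=; apply: eq_bigr => w _.
  by rewrite !inE; case: (w != v); case: (w \in e); rewrite ?mul1r ?mul0r.
rewrite exchange_big /=; apply: eq_bigr => w wv.
rewrite -mulr_suml; congr (_ * _).
have uniq e : e \in F -> v \in e -> w \in e -> e = [set v; w].
  move=> eF ve we; apply/esym/eqP; rewrite eqEcard cards2 eq_sym wv F2 // andbT.
  by apply/fintype.subsetP => z; rewrite !inE => /orP[] /eqP ->.
rewrite /adj; case: (boolP ([set v; w] \in F)) => vwF.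
  rewrite (bigD1 [set v; w]) //= !inE !eqxx orbT big1 ?addr0// => e /andP[eF ne].
  case: (boolP (v \in e)) => //= ve; case: (boolP (w \in e)) => //= we.
  by rewrite (uniq e) ?eqxx // in ne.
apply: big1 => e eF.
case: (boolP (v \in e)) => //= ve; case: (boolP (w \in e)) => //= we.
by rewrite -(uniq e) ?eF // in vwF.
Qed.

Lemma degree_adj (R : realType) (V : finType) (F : {set {set V}}) (v : V) :
  simple_graph F ->
  #|[set e in F | v \in e]|%:R = \sum_(w | w != v) (adj F v w)%:R :> R.
Proof.
move=> F2.
have := sum_edges_adj (fun a _ => (a == v)%:R : R) F2.
rewrite [RHS](bigD1 v) //= [X in _ = _ + X]big1 ?addr0 => [|a av]; last first.
  by apply: big1 => w _; rewrite (negbTE av) mulr0.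
under [RHS]eq_bigr do rewrite eqxx mulr1.
move=> <-; rewrite -sum1_card natr_sum.
under eq_bigl do rewrite inE.
rewrite big_mkcondr /=; apply: eq_bigr => e eF.
case: ifP => ve; last first.
  rewrite big1 // => a ae; rewrite big1 // => w _.
  by case: eqP => // av; rewrite -av ae in ve.
rewrite (bigD1 v) //= [X in _ = _ + X]big1 ?addr0 => [|a /andP[_ av]]; last first.
  by apply: big1 => w _; rewrite (negbTE av).
rewrite eqxx sumr_const; have := F2 _ eF.
by rewrite (cardsD1 v) ve add1n => -[->].
Qed.

Lemma laplacian_sym (R : realType) (V : finType) (W : {set V}) (F : {set {set V}}) :
  (laplacian R W F)^T = laplacian R W F.
Proof.
by apply/matrixP => r c; rewrite !mxE eq_sym; case: eqP => [->|_] //; rewrite adjC.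
Qed.

Definition restrict (R : realType) (V : finType) (W : {set V}) (g : V -> R) :
  'rV[R]_#|W| := \row_r g (enum_val r).

Lemma restrict_surj (R : realType) (V : finType) (W : {set V}) (y : 'rV[R]_#|W|) :
  exists g, y = restrict W g.
Proof.
exists (fun v => \sum_(r | enum_val r == v) y 0 r).
apply/rowP => r; rewrite mxE (bigD1 r) //= big1 ?addr0// => s /andP[/eqP sr].
by rewrite (enum_val_inj sr) eqxx.
Qed.

Section Laplacian.
Context (R : realType) (V : finType) (W : {set V}) (F : {set {set V}}).
Hypotheses (F2 : simple_graph F) (FW : forall e, e \in F -> e \subset W).

Lemma mul_laplacian (g : V -> R) (c : 'I_#|W|) :
  (restrict W g *m laplacian R W F) 0 c =
  \sum_(w | w != enum_val c) (adj F (enum_val c) w)%:R * (g (enum_val c) - g w).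
Proof.
set v := enum_val c.
transitivity (\sum_(w in W) g w *
    (if w == v then #|[set e in F | v \in e]|%:R else - (adj F v w)%:R)).
  rewrite mxE [RHS]big_enum_val; apply: eq_bigr => r _; rewrite !mxE.
  rewrite (inj_eq enum_val_inj) adjC.
  by case: eqP => [->|].
rewrite (bigD1 v) ?enum_valP //= eqxx degree_adj // mulr_sumr.
rewrite (_ : \sum_(i in W | _) _ = \sum_(w | w != v) - g w * (adj F v w)%:R).
  rewrite -big_split /=; apply: eq_bigr => w _; ring.
rewrite big_mkcond [RHS]big_mkcond /=; apply: eq_bigr => w _.
case: eqP => [->|_]; rewrite ?andbF //= andbT.
case: ifP => [_|wW]; first by rewrite mulrN mulNr.
(* Edges lie inside [W], so the sum may be extended from [W] to all of [V]. *)
suff -> : adj F v w = false by rewrite mulr0.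
apply/negP => /FW /fintype.subsetP /(_ w).
by rewrite !inE eqxx orbT wW => /(_ isT).
Qed.

Lemma qform_laplacian (g : V -> R) :
  qform (laplacian R W F) (restrict W g) = \sum_(e in F) edge_sqdiff g e.
Proof.
rewrite /qform mul_tr00 sum_edges_adj //.
under eq_bigr do rewrite mul_laplacian mxE.
rewrite -(big_enum_val
  (fun v => (\sum_(w | w != v) (adj F v w)%:R * (g v - g w)) * g v)) /=.
rewrite big_mkcond /=; apply: eq_bigr => v _; case: ifP => [_|vW].
  by rewrite mulr_suml; apply: eq_bigr => w _; ring.
apply/esym/big1 => w _; suff -> : adj F v w = false by rewrite mul0r.
apply/negP => /FW /fintype.subsetP /(_ v).
by rewrite !inE eqxx vW => /(_ isT).
Qed.

Lemma sqn_restrict (g : V -> R) : sqn (restrict W g) = \sum_(v in W) g v ^+ 2.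
Proof. by rewrite [RHS]big_enum_val; apply: eq_bigr => r _; rewrite mxE. Qed.

(** The Laplacian form is a sum of squared differences along edges. Where it vanishes, the function
    is constant along paths, hence on the connected [W], and [lambda2_spec] applies. *)
Lemma laplacian_lambda2 : graph_connected W F -> (1 < #|W|)%N ->
  0 < lambda 2 (laplacian R W F) /\
  forall g : V -> R, \sum_(v in W) g v = 0 ->
    lambda 2 (laplacian R W F) * \sum_(v in W) g v ^+ 2 <=
    \sum_(e in F) edge_sqdiff g e.
Proof.
move=> [_ conn] W1.
have psd y : 0 <= qform (laplacian R W F) y.
  have [g ->] := restrict_surj y; rewrite qform_laplacian.
  by apply: sumr_ge0 => e /F2; exact: edge_sqdiff_ge0.
have const0 : const_mx 1 *m laplacian R W F = 0 :> 'rV_#|W|.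
  have -> : (const_mx 1 : 'rV[R]_#|W|) = restrict W (fun=> 1).
    by apply/rowP => r; rewrite !mxE.
  apply/rowP => c; rewrite mul_laplacian mxE.
  by apply: big1 => w _; rewrite subrr mulr0.
have ker (y : 'rV_#|W|) : y *m laplacian R W F = 0 -> exists a, y = const_mx a.
  have [g ->] := restrict_surj y => yL.
  have : \sum_(e in F) edge_sqdiff g e = 0.
    by rewrite -qform_laplacian /qform yL mul0mx mxE.
  move/eqP; rewrite psumr_eq0 => [/allP h|e /F2]; last exact: edge_sqdiff_ge0.
  have gadj u v : adj F u v -> g u = g v.
    move=> uv; have /(_ [set u; v]) := h; rewrite mem_index_enum => /(_ isT).
    have nuv : u != v by have := F2 uv; rewrite cards2; case: eqP.
    rewrite (uv : [set u; v] \in F) /= edge_sqdiff_pair // sqrf_eq0 subr_eq0.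
    by move/eqP.
  have gconn u v : connect (adj F) u v -> g u = g v.
    move=> /connectP[s]; elim: s u => [|w s IH] u /=; first by move=> _ ->.
    by move=> /andP[/gadj -> /IH]; exact.
  have i0 : 'I_#|W| := Ordinal (ltnW W1).
  exists (g (enum_val i0)); apply/rowP => r; rewrite !mxE.
  by apply: gconn; apply: conn; exact: enum_valP.
have [l0 hl] := lambda2_spec (laplacian_sym R W F) W1 psd const0 ker.
split=> // g g0; rewrite -sqn_restrict -qform_laplacian; apply: hl.
apply/matrixP => i j; rewrite !ord1 mul_tr00 mxE -[RHS]g0 [RHS]big_enum_val.
by apply: eq_bigr => r _; rewrite !mxE mulr1.
Qed.

Lemma alg_connectivity_gt0 : graph_connected W F ->
  (0 < alg_connectivity R W F)%E.
Proof.
move=> conn; rewrite /alg_connectivity; case: eqP => // /eqP W1.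
have W0 : (0 < #|W|)%N by rewrite card_gt0; case: conn.
by rewrite lte_fin; apply: (laplacian_lambda2 conn _).1; lia.
Qed.

Lemma poincare (c : R) (g : V -> R) : graph_connected W F ->
  (c%:E <= alg_connectivity R W F)%E -> \sum_(v in W) g v = 0 ->
  c * \sum_(v in W) g v ^+ 2 <= \sum_(e in F) edge_sqdiff g e.
Proof.
move=> conn; rewrite /alg_connectivity; case: eqP => [/eqP/cards1P[v ->] _|/eqP W1].
  (* On a single vertex mean zero means [g v = 0], so the bound holds for every [c], in accordance
     with the value [+oo]. *)
  rewrite !big_set1 => ->; rewrite expr0n mulr0.
  by apply: sumr_ge0 => e /F2; exact: edge_sqdiff_ge0.
have W0 : (0 < #|W|)%N by rewrite card_gt0; case: conn.
rewrite lee_fin => cl g0.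
apply: le_trans ((laplacian_lambda2 conn _).2 _ g0); last by lia.
by apply: ler_wpM2r => //; apply: sumr_ge0 => v _; exact: sqr_ge0.
Qed.

End Laplacian.

(** * Trivial motions *)

Lemma exists_nonroot (R : realType) (p : {poly R}) : p != 0 -> exists s, p.[s] != 0.
Proof.
move=> p0; apply: contrapT => noroot.
have := @max_poly_roots R p [seq i%:R | i <- iota 0 (size p)] p0.
rewrite size_map size_iota ltnn => h; apply: notF; apply: h.
  apply/allP => s _; rewrite rootE; apply: contrapT => ps.
  by apply: noroot; exists s; apply/negP.
rewrite map_inj_uniq ?iota_uniq // => i j /eqP; rewrite eqr_nat.
by move/eqP.
Qed.

(* Rank is lower semicontinuous, and [s A + B] is, up to scaling, the
   perturbation [A + B / s] of [A]. *)
Lemma rank_le_generic (R : realType) (m n r : nat) (A B : 'M[R]_(m, n)) (g : {poly R}) :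
  g != 0 -> (forall s, g.[s] != 0 -> (\rank (s *: A + B)%R <= r)%N) ->
  (\rank A <= r)%N.
Proof.
move=> g0 hr; set rA := \rank A.
pose L := col_ebase A; pose U := row_ebase A.
have eA : A = L *m pid_mx rA *m U by rewrite mulmx_ebase.
pose X : 'M[R]_(rA, m) := pid_mx rA *m invmx L.
pose Y : 'M[R]_(n, rA) := invmx U *m pid_mx rA.
have XAY : X *m A *m Y = 1%:M.
  rewrite /X /Y {1}eA !mulmxA mulmxKV ?col_ebase_unit //.
  rewrite -(mulmxA _ U) mulmxV ?row_ebase_unit // mulmx1.
  rewrite !mul_pid_mx; apply: etrans (pid_mx_1 _ _); congr pid_mx.
  by have := rank_leq_row A; have := rank_leq_col A; rewrite -/rA; lia.
pose M := X *m B *m Y.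
have := @exists_nonroot R (g * char_poly (- M)).
rewrite mulf_neq0 ?(monic_neq0 (char_poly_monic _)) // => /(_ isT)[s].
rewrite hornerM mulf_eq0 negb_or => /andP[gs].
rewrite -[_ == 0]/(root _ _) -eigenvalue_root_char /eigenvalue negbK.
rewrite /eigenspace kermx_eq0 => free.
have rk : rA = \rank (X *m (s *: A + B) *m Y).
  rewrite mulmxDr mulmxDl -scalemxAr -scalemxAl XAY scalemx1 -/M.
  by rewrite -mxrank_opp opprD addrC; apply/esym/eqP.
apply: leq_trans (eq_leq rk) (leq_trans _ (hr s gs)).
apply: leq_trans (mxrankM_maxl _ _) _.
exact: mxrankM_maxr.
Qed.

Definition ord_pairs (n : nat) : {set 'I_n * 'I_n} :=
  [set ij : 'I_n * 'I_n | (ij.1 < ij.2)%N].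

Lemma sum_ord_pairs (R : realType) (n : nat) (h : 'I_n * 'I_n -> R) :
  \sum_(ij in ord_pairs n) h ij = \sum_(i < n) \sum_(j < n | (i < j)%N) h (i, j).
Proof.
rewrite pair_big_dep /=; apply: eq_big => -[i j]; last by [].
by rewrite inE.
Qed.

Lemma card_ord_pairs (n : nat) : #|ord_pairs n| = 'C(n, 2).
Proof.
rewrite -bin2_sum big_mkord -sum1_card.
rewrite (eq_bigl (fun ij : 'I_n * 'I_n => true && (ij.1 < ij.2)%N)); last first.
  by move=> ij; rewrite inE.
rewrite -(pair_big_dep xpredT (fun i j : 'I_n => (i < j)%N) (fun _ _ => 1%N)) /=.
rewrite (exchange_big_dep xpredT) //=; apply: eq_bigr => j _.
rewrite sum1_card.
transitivity #|[set widen_ord (ltnW (ltn_ord j)) k | k : 'I_j]|.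
  apply: eq_card => i; apply/idP/imsetP => [ij|[k _ ->]]; last exact: (ltn_ord k).
  by exists (Ordinal (ij : (i < j)%N)) => //; exact: val_inj.
by rewrite card_imset ?card_ord // => k l /(congr1 val) /= /val_inj.
Qed.

Definition homogeneous (R : realType) (d : nat) (y : 'rV[R]_d) (i : 'I_d.+1) : R :=
  if unlift ord_max i is Some k then y 0 k else 1.

(* Row (i, j) is the trivial motion [v |-> (E_ij - E_ji)] applied to the
   homogeneous coordinates of [p v], with the last coordinate dropped. *)
Definition trivial_motions (R : realType) (V : finType) (d : nat)
    (p : V -> 'rV[R]_d) : 'M[R]_(#|ord_pairs d.+1|, #|{: V * 'I_d}|) :=
  \matrix_(q, r) let: (v, k) := enum_val r in let: (i, j) := enum_val q in
    homogeneous (p v) i * (j == lift ord_max k)%:R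
    - homogeneous (p v) j * (i == lift ord_max k)%:R.

Lemma homogeneous_max (R : realType) (d : nat) (y : 'rV[R]_d) :
  homogeneous y ord_max = 1.
Proof. by rewrite /homogeneous unlift_none. Qed.

Lemma homogeneous_lift (R : realType) (d : nat) (y : 'rV[R]_d) k :
  homogeneous y (lift ord_max k) = y 0 k.
Proof. by rewrite /homogeneous liftK. Qed.

(** An antisymmetric matrix has zero quadratic form: with [D] the difference of the homogeneous
    coordinates, the product is [D i * D j - D j * D i]. Dropping the last coordinate is harmless,
    as that of [D] is 0. *)
Lemma dot_trivial_motion (R : realType) (V : finType) (d : nat)
    (p : V -> 'rV[R]_d) q (u v : V) :
  dot (field_at (row q (trivial_motions p)) u - field_at (row q (trivial_motions p)) v)
      (p u - p v) = 0.
Proof.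
case eq: (enum_val q) => [i j].
pose D a := homogeneous (p u) a - homogeneous (p v) a.
have sumD a : \sum_k (a == lift ord_max k)%:R * D (lift ord_max k) = D a.
  case: (unliftP ord_max a) => [k ->|->].
    rewrite (bigD1 k) //= eqxx mul1r big1 ?addr0 // => l lk.
    by rewrite (inj_eq lift_inj) eq_sym (negbTE lk) mul0r.
  rewrite {2}/D !homogeneous_max subrr big1 // => l _.
  by rewrite (negbTE (neq_lift _ _)) mul0r.
transitivity (\sum_k (D i * ((j == lift ord_max k)%:R * D (lift ord_max k))
                    - D j * ((i == lift ord_max k)%:R * D (lift ord_max k)))).
  apply: eq_bigr => k _; rewrite !mxE !enum_rankK eq.
  by rewrite {2 4}/D !homogeneous_lift /D; ring.
by rewrite sumrB -!mulr_sumr !sumD mulrC subrr.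
Qed.

(** The coefficients of a linear relation form an antisymmetric matrix [B]. The relation at the
    points [p (l a)] says that [H] annihilates every column of [B] but the last, so these columns
    vanish. *)
Lemma row_free_trivial_motions (R : realType) (V : finType) (d : nat)
    (p : V -> 'rV[R]_d) (l : 'I_d.+1 -> V) :
  (\matrix_(a, i) homogeneous (p (l a)) i) \in unitmx ->
  row_free (trivial_motions p).
Proof.
set H := (X in X \in _) => Hunit; apply: inj_row_free => c.
have [g ->] := restrict_surj c => gT.
pose B (a b : 'I_d.+1) : R :=
  (a < b)%N%:R * g (a, b) - (b < a)%N%:R * g (b, a).
have HB k : H *m (\col_a B a (lift ord_max k)) = 0.
  apply/matrixP => a z; rewrite !mxE.
  set L := lift ord_max k.
  move/rowP/(_ (enum_rank (l a, k))): gT; rewrite !mxE => gT0; apply: etrans gT0.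
  pose h (ij : 'I_d.+1 * 'I_d.+1) := g ij *
     (homogeneous (p (l a)) ij.1 * (ij.2 == L)%:R
      - homogeneous (p (l a)) ij.2 * (ij.1 == L)%:R).
  rewrite (eq_bigr (fun q => h (enum_val q))); last first.
    by move=> q _; rewrite !mxE enum_rankK /h; case: (enum_val q).
  rewrite -(big_enum_val h) sum_ord_pairs /h /=.
  under [RHS]eq_bigr do rewrite big_mkcond /=.
  transitivity (\sum_(i < d.+1) \sum_(j < d.+1)
      ((i < j)%N%:R * g (i, j) * homogeneous (p (l a)) i * (j == L)%:R
       - (i < j)%N%:R * g (i, j) * homogeneous (p (l a)) j * (i == L)%:R)); last first.
    apply: eq_bigr => i _; apply: eq_bigr => j _.
    by case: ifP => _ /=; ring.
  under [RHS]eq_bigr do rewrite sumrB.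
  rewrite sumrB [X in _ = _ - X]exchange_big /= -sumrB.
  apply: eq_bigr => i _; rewrite !mxE.
  rewrite [X in _ = X - _](bigD1 L) //= [X in _ = _ + X - _]big1; last first.
    by move=> j /negbTE ->; rewrite mulr0.
  rewrite [X in _ = _ - X](bigD1 L) //= [X in _ = _ - (_ + X)]big1; last first.
    by move=> j /negbTE ->; rewrite mulr0.
  rewrite !eqxx /B /=; ring.
have B0 a k : B a (lift ord_max k) = 0.
  have : invmx H *m (H *m (\col_a B a (lift ord_max k))) = 0.
    by rewrite HB mulmx0.
  by rewrite mulKmx // => /matrixP/(_ a 0); rewrite !mxE.
apply/rowP => q; rewrite !mxE; have := enum_valP q.
case: (enum_val q) => i j; rewrite inE /= => ij.
(* As [i < j], the index [i] is not the last one, and [- g (i, j)] is an entry of a vanishing column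
   of [B]. *)
case: (unliftP ord_max i) => [k ik|im]; last first.
  by move: ij; rewrite im /= ltnNge -ltnS ltn_ord.
have := B0 j k; rewrite -ik /B ij (ltnNge j i) (ltnW ij) /= mul0r mul1r sub0r.
by move/eqP; rewrite oppr_eq0 => /eqP.
Qed.

(** For affinely independent [p (l a)], the trivial motions are ['C(d.+1, 2)] independent vectors of
    the left kernel. *)
Lemma rank_edge_mx_spanning (R : realType) (V : finType) (d : nat)
    (E : {set {set V}}) (p : V -> 'rV[R]_d) (l : 'I_d.+1 -> V) :
  simple_graph E -> (\matrix_(a, i) homogeneous (p (l a)) i) \in unitmx ->
  (\rank (edge_mx E (fun u v => p u - p v)%R) <= d * #|V| - 'C(d.+1, 2))%N.
Proof.
move=> E2 /row_free_trivial_motions /eqP rkT.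
set M := edge_mx _ _.
have TM : trivial_motions p *m M = 0.
  apply/matrixP => q c.
  have -> : (trivial_motions p *m M) q c = (row q (trivial_motions p) *m M) 0 c.
    by rewrite -row_mul [RHS]mxE.
  rewrite mul_edge_mx mxE; have := E2 _ (enum_valP c).
  move/eqP/cards2P => [u [v [uv ->]]].
  rewrite stretch_pair // ?dot_trivial_motion // => a b.
  by rewrite opprB.
have NE : #|{: V * 'I_d}| = (d * #|V|)%N by rewrite card_prod card_ord mulnC.
by have := mulmx0_rank_max TM; rewrite rkT card_ord_pairs; lia.
Qed.

Lemma edge_mx_lin (R : realType) (V : finType) (d : nat) (E : {set {set V}})
    (D D' : V -> V -> 'rV[R]_d) (s : R) :
  edge_mx E (fun u v => s *: D u v + D' u v) = s *: edge_mx E D + edge_mx E D'.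
Proof.
apply/matrixP => r c; rewrite !mxE; case: (enum_val r) => w k /=.
case: ifP => _; last by rewrite mulr0 addr0.
by rewrite mulr_sumr -big_split; apply: eq_bigr => x _; rewrite !mxE.
Qed.

(** The points of [p] may lie in a hyperplane, so [p] is replaced by the pencil [s p + q] with [q]
    spanning; [rank_le_generic] carries the bound back to [p]. *)
Lemma rank_edge_mx (R : realType) (V : finType) (d : nat)
    (E : {set {set V}}) (p : V -> 'rV[R]_d) :
  simple_graph E -> (d.+1 <= #|V|)%N ->
  (\rank (edge_mx E (fun u v => p u - p v)%R) <= d * #|V| - 'C(d.+1, 2))%N.
Proof.
move=> E2 hV.
pose l (a : 'I_d.+1) : V := enum_val (widen_ord hV a).
(* The first [d] of the chosen vertices go to the unit vectors and the last to the origin, so [Q] is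
   triangular with unit diagonal. *)
pose q (v : V) : 'rV[R]_d := \row_k (enum_rank v == k :> nat)%:R.
(* The column of ones is left to [Q], so that [s *: P + Q] holds the homogeneous coordinates of
   [s *: p + q]. *)
pose P := \matrix_(a < d.+1, i < d.+1)
  (if unlift ord_max i is Some k then p (l a) 0 k else 0).
pose Q := \matrix_(a < d.+1, i < d.+1) homogeneous (q (l a)) i.
have detQ : \det Q = 1.
  rewrite -det_tr det_trig; last first.
    apply/is_trig_mxP => i a ia; rewrite !mxE.
    case: (unliftP ord_max i) => [k ik|im]; last first.
      by move: ia; rewrite im /= ltnNge -ltnS ltn_ord.
    rewrite ik homogeneous_lift mxE enum_valK /=.
    move: ia; rewrite ik /= /bump (leqNgt d k) ltn_ord add0n => ia.
    by rewrite gtn_eqF.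
  apply: big1 => i _; rewrite !mxE.
  case: (unliftP ord_max i) => [k ->|->]; last by rewrite homogeneous_max.
  rewrite homogeneous_lift mxE enum_valK /= /bump (leqNgt d k) ltn_ord add0n.
  by rewrite eqxx.
pose g : {poly R} := \det ('X *: map_mx polyC P + map_mx polyC Q).
have gE s : g.[s] = \det (s *: P + Q).
  rewrite -[LHS]/(horner_eval s g) -det_map_mx; congr (\det _).
  apply/matrixP => a i; rewrite !mxE /= /horner_eval hornerD hornerM.
  by rewrite hornerX !hornerC.
apply: (@rank_le_generic _ _ _ _ _ (edge_mx E (fun u v => q u - q v)) g).
  apply/eqP => g0; have := gE 0.
  by rewrite g0 horner0 scale0r add0r detQ => /eqP; rewrite eq_sym oner_eq0.
move=> s; rewrite gE => det0; rewrite -edge_mx_lin.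
have -> : edge_mx E (fun u v => s *: (p u - p v) + (q u - q v)) =
    edge_mx E (fun u v => (fun w => s *: p w + q w) u - (fun w => s *: p w + q w) v).
  congr edge_mx; apply/funext => u; apply/funext => v /=.
  by rewrite scalerBr addrACA opprD.
apply: (@rank_edge_mx_spanning _ _ _ _ _ l) => //.
rewrite unitmxE unitfE; suff <- : s *: P + Q =
    \matrix_(a, i) homogeneous (s *: p (l a) + q (l a)) i by [].
apply/matrixP => a i; rewrite !mxE /homogeneous.
by case: unlift => [k|]; rewrite ?mxE // mulr0 add0r.
Qed.

Lemma enormN (R : realType) (d : nat) (y : 'rV[R]_d) : enorm (- y) = enorm y.
Proof. by congr Num.sqrt; apply: eq_bigr => k _; rewrite mxE sqrrN. Qed.

Lemma direction_anti (R : realType) (V : finType) (d : nat) (p : V -> 'rV[R]_d) u v :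
  direction p v u = - direction p u v.
Proof. by rewrite /direction -(opprB (p u)) enormN scalerN. Qed.

(** A field with no stretch along [p u - p v] has none along its multiples, so normalization can
    only enlarge the left kernel. *)
Lemma rank_rigidity_mx (R : realType) (V : finType) (d : nat)
    (E : {set {set V}}) (p : V -> 'rV[R]_d) :
  simple_graph E -> (d.+1 <= #|V|)%N ->
  (\rank (rigidity_mx E p) <= d * #|V| - 'C(d.+1, 2))%N.
Proof.
move=> E2 hV; apply: leq_trans _ (rank_edge_mx p E2 hV).
set M := edge_mx _ _.
suff kerS : (kermx M <= kermx (rigidity_mx E p))%MS.
  have := mxrankS kerS; rewrite !mxrank_ker.
  by have := rank_leq_row M; have := rank_leq_row (rigidity_mx E p); lia.
apply/row_subP => i; apply/sub_kermxP; set x := row i _.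
have /rowP xM : x *m M = 0 by apply/sub_kermxP; exact: row_sub.
apply/rowP => c; have := xM c.
rewrite rigidity_edge_mx !mul_edge_mx !mxE; have := E2 _ (enum_valP c).
move/eqP/cards2P => [u [v [uv ->]]].
rewrite !stretch_pair // => [||a b]; last 2 first.
- by move=> a b; exact: direction_anti.
- by rewrite opprB.
by rewrite dotZr => ->; rewrite mulr0.
Qed.

(** * The limit form *)

Lemma dotC (R : realType) (d : nat) (y z : 'rV[R]_d) : dot y z = dot z y.
Proof. by apply: eq_bigr => k _; rewrite mulrC. Qed.

(* The columns of an orthogonal matrix with constant first row are, once that
   row is deleted, the vertices of a regular simplex. *)
Lemma regular_simplex (R : realType) (d : nat) :
  exists X : 'I_d.+1 -> 'rV[R]_d,
    (forall i j, i != j -> sqn (X i - X j) = 2) /\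
    (forall i z, sqn z <= \sum_j dot z (X i - X j) ^+ 2).
Proof.
pose a : R := (Num.sqrt d.+1%:R)^-1.
have a2 : a ^+ 2 = d.+1%:R^-1 by rewrite exprVn sqr_sqrtr.
have a0 : a != 0 by rewrite invr_eq0 sqrtr_eq0 -ltNge ltr0n.
have v1 : sqn (const_mx a : 'rV[R]_d.+1) = 1.
  rewrite /sqn; under eq_bigr do rewrite mxE a2.
  by rewrite sumr_const card_ord -[X in X *+ _]mul1r -mulrnAr -mulr_natl divff ?mulr1.
have [H HHt rH] := orthogonal_completion v1.
have H0 j : H 0 j = a by move/rowP/(_ j): rH; rewrite !mxE.
have HtH : H^T *m H = 1%:M by exact: mulmx1C.
have colH i j : \sum_b H b i * H b j = (i == j)%:R.
  by move/matrixP/(_ i j): HtH; rewrite !mxE => <-; apply: eq_bigr => b _; rewrite mxE.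
have rowH b c : \sum_j H b j * H c j = (b == c)%:R.
  by move/matrixP/(_ b c): HHt; rewrite !mxE => <-; apply: eq_bigr => j _; rewrite mxE.
pose X' := row' 0 H.
have XX : X' *m X'^T = 1%:M.
  apply/matrixP => k l; rewrite !mxE -(inj_eq (@lift_inj _ 0)) -rowH.
  by apply: eq_bigr => j _; rewrite !mxE.
exists (fun j => \row_k H (lift 0 k) j); split=> [i j ij|i z].
  transitivity (\sum_b (H b i - H b j) ^+ 2).
    rewrite big_ord_recl !H0 subrr expr0n add0r.
    by apply: eq_bigr => k _; rewrite !mxE.
  transitivity (\sum_b (H b i * H b i - 2 * (H b i * H b j) + H b j * H b j)).
    by apply: eq_bigr => b _; ring.
  rewrite big_split sumrB -mulr_sumr /= !colH !eqxx (negbTE ij) mulr0 subr0.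
  by [].
(* [y 0 j] is the product of [z] with the j-th simplex vertex. The rows of [X'] are orthogonal to
   the constant row, so [y] has sum zero, the cross terms cancel, and [(d + 1) y_i^2 + |y|^2]
   remains, with [|y| = |z|]. *)
pose y := z *m X'.
have yE j : dot z (\row_k H (lift 0 k) j) = y 0 j.
  by rewrite mxE; apply: eq_bigr => k _; rewrite !mxE.
have sy : \sum_j y 0 j = 0.
  under eq_bigr do rewrite mxE.
  rewrite exchange_big /= big1 // => k _; rewrite -mulr_sumr.
  suff -> : \sum_j X' k j = 0 by rewrite mulr0.
  have := rowH 0 (lift 0 k); under eq_bigr do rewrite H0.
  rewrite -mulr_sumr (negbTE (neq_lift _ _)) => /eqP.
  rewrite mulf_eq0 (negbTE a0) /= => /eqP s0; apply: etrans s0.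
  by apply: eq_bigr => j _; rewrite mxE.
rewrite -(sqn_orthogonal z XX) -/y /sqn.
have -> : \sum_j dot z (\row_k H (lift 0 k) i - \row_k H (lift 0 k) j) ^+ 2
   = \sum_j (y 0 i ^+ 2 - 2 * y 0 i * y 0 j + y 0 j ^+ 2).
  by apply: eq_bigr => j _; rewrite dotC dotBl !(dotC _ z) !yE; ring.
have cross : \sum_j 2 * y 0 i * y 0 j = 0 by rewrite -mulr_sumr sy mulr0.
rewrite big_split sumrB cross subr0 /= lerDr.
by apply: sumr_ge0 => j _; exact: sqr_ge0.
Qed.

(* The kernel consists of the fields whose component along [X i - X j] sums to
   zero over [VP i :|: VP j], for every pair i < j. *)
Definition constraint_mx (R : realType) (V : finType) (d : nat)
    (VP : 'I_d.+1 -> {set V}) (X : 'I_d.+1 -> 'rV[R]_d) :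
    'M[R]_(#|{: V * 'I_d}|, #|ord_pairs d.+1|) :=
  \matrix_(r, q) let: (v, k) := enum_val r in let: (i, j) := enum_val q in
    (v \in VP i :|: VP j)%:R * (X i - X j) 0 k.

Lemma constraint_mxP (R : realType) (V : finType) (d : nat)
    (VP : 'I_d.+1 -> {set V}) (X : 'I_d.+1 -> 'rV[R]_d)
    (x : 'rV[R]_#|{: V * 'I_d}|) (i j : 'I_d.+1) :
  x *m constraint_mx VP X = 0 -> (i < j)%N ->
  \sum_(v in VP i :|: VP j) dot (field_at x v) (X i - X j) = 0.
Proof.
move=> xC ij; have ijP : (i, j) \in ord_pairs d.+1 by rewrite inE.
move/rowP/(_ (enum_rank_in ijP (i, j))): xC; rewrite mxE [RHS]mxE => xC.
apply: etrans xC; rewrite sum_enum_pair big_mkcond /=; apply: eq_bigr => v _.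
case: ifP => vV; last first.
  apply/esym/big1 => k _; rewrite mxE enum_rankK enum_rankK_in // vV.
  by rewrite mul0r mulr0.
by apply: eq_bigr => k _; rewrite !mxE enum_rankK enum_rankK_in // vV mul1r !mxE.
Qed.

Section RigidPartition.
Context (R : realType) (V : finType) (d : nat) (E : {set {set V}}).
Context (VP : 'I_d.+1 -> {set V}) (EP : 'I_d.+1 -> 'I_d.+1 -> {set {set V}}).
Hypotheses (hE : simple_graph E) (hP : rigid_partition E VP EP).
Variable X : 'I_d.+1 -> 'rV[R]_d.
Hypothesis X_frame : forall i z, sqn z <= \sum_j dot z (X i - X j) ^+ 2.

Lemma part_of (v : V) : exists i, v \in VP i.
Proof.
have : v \in [set: V] by rewrite inE.
by rewrite -(rp_cover_V hP) => /bigcupP[i _ vi]; exists i.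
Qed.

Lemma part_inj (v : V) i j : v \in VP i -> v \in VP j -> i = j.
Proof.
move=> vi vj; apply/eqP; apply: contraT => /(rp_disjoint_V hP).
by move/disjoint_setI0/setP/(_ v); rewrite !inE vi vj.
Qed.

Lemma part_graph_simple (i j : 'I_d.+1) : (i < j)%N -> simple_graph (EP i j).
Proof. by move=> ij e /(fintype.subsetP (rp_sub_E hP ij)); exact: hE. Qed.

(** The pairs [i < j] seen by [v] are those containing its part [i0]; this turns the sum over
    classes into the sum of the frame inequality. *)
Lemma sum_pairs_part (h : 'I_d.+1 -> 'I_d.+1 -> R) (i0 : 'I_d.+1) (v : V) :
  (forall i j, h i j = h j i) -> (forall i, h i i = 0) -> v \in VP i0 ->
  \sum_(ij in ord_pairs d.+1) (v \in VP ij.1 :|: VP ij.2)%:R * h ij.1 ij.2 =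
  \sum_j h i0 j.
Proof.
move=> hC h0 vi0; rewrite sum_ord_pairs /=.
have inVP i : (v \in VP i) = (i == i0).
  by apply/idP/eqP => [vi|->//]; exact: part_inj vi vi0.
transitivity (\sum_(i < d.+1) \sum_(j < d.+1)
    ((i == i0)%:R * ((i < j)%N%:R * h i j) + (j == i0)%:R * ((i < j)%N%:R * h i j))).
  apply: eq_bigr => i _; rewrite big_mkcond; apply: eq_bigr => j _ /=.
  rewrite inE !inVP; case: ltnP => ij; last by rewrite !(mul0r, mulr0) addr0.
  case: (eqVneq i i0) => ii; case: (eqVneq j i0) => jj /=; try ring.
  by move: ij; rewrite ii jj ltnn.
under [LHS]eq_bigr do rewrite big_split /=.
rewrite big_split /= [X in _ + X]exchange_big /=.
rewrite (bigD1 i0) //= [X in _ + X + _]big1 ?addr0 => [|i /negbTE ->]; last first.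
  by apply: big1 => j _; rewrite mul0r.
rewrite [X in _ + X](bigD1 i0) //= [X in _ + (_ + X)]big1 ?addr0; last first.
  move=> i /negbTE ->.
  by apply: big1 => j _; rewrite mul0r.
rewrite -big_split /=; apply: eq_bigr => j _; rewrite eqxx !mul1r.
by rewrite (hC j i0); case: (ltngtP i0 j) => [_|_|/val_inj ->]; rewrite ?h0 /=; ring.
Qed.

(** An edge of [E_ij] is stretched by [s] times the difference of the component along [X i - X j],
    so each class contributes half a Laplacian form; the frame inequality collects the components at
    each vertex. *)
Lemma limit_form_ge (D : V -> V -> 'rV[R]_d) (c : R) (x : 'rV[R]_#|{: V * 'I_d}|) :
  (forall u v, D v u = - D u v) ->
  (forall (i j : 'I_d.+1) u v, (i < j)%N -> u != v -> [set u; v] \in EP i j ->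
     exists2 s, s ^+ 2 = 2^-1 & D u v = s *: (X i - X j)) ->
  0 <= c ->
  (forall i j : 'I_d.+1, (i < j)%N ->
     ((c * 2)%:E <= alg_connectivity R (VP i :|: VP j) (EP i j))%E) ->
  x *m constraint_mx VP X = 0 ->
  c * sqn x <= sqn (x *m edge_mx E D).
Proof.
move=> Danti Dedge c0 hc xC.
pose g (i j : 'I_d.+1) v := dot (field_at x v) (X i - X j).
pose F (ij : 'I_d.+1 * 'I_d.+1) := \sum_(e in EP ij.1 ij.2) stretch D x e ^+ 2.
(* The classes are disjoint, so each edge of [E] is counted at most once on the left. *)
have step1 : \sum_(ij in ord_pairs d.+1) F ij <= sqn (x *m edge_mx E D).
  rewrite sqn_edge_mx /F.
  rewrite (eq_bigr (fun ij : 'I_d.+1 * 'I_d.+1 =>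
    \sum_(e in E) (e \in EP ij.1 ij.2)%:R * stretch D x e ^+ 2)); last first.
    move=> [i j]; rewrite inE /= => ij.
    rewrite big_mkcond [RHS]big_mkcond /=; apply: eq_bigr => e _.
    case: ifP => eij; last by rewrite mul0r; case: ifP.
    by rewrite (fintype.subsetP (rp_sub_E hP ij)) // mul1r.
  rewrite exchange_big /=; apply: ler_sum => e _; rewrite -mulr_suml.
  rewrite -[leRHS]mul1r ler_wpM2r ?sqr_ge0 //.
  case: (pickP (fun ij : 'I_d.+1 * 'I_d.+1 =>
    (ij \in ord_pairs d.+1) && (e \in EP ij.1 ij.2)))
    => [ij /andP[ijP eij]|none]; last first.
    rewrite big1 // => ij ijP; have := none ij; rewrite ijP /=.
    by move->.
  rewrite (bigD1 ij) //= eij big1 ?addr0 // => kl /andP[klP ne].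
  case: (boolP (e \in _)) => // ekl.
  move: ijP klP; rewrite !inE => ijP klP.
  have := rp_disjoint_E hP klP ijP; rewrite -!surjective_pairing => /(_ ne).
  by move/disjoint_setI0/setP/(_ e); rewrite !inE ekl eij.
apply: le_trans step1.
(* The factor [s ^+ 2 = 2^-1] meets the Poincare constant [c * 2] and leaves [c]. *)
have step2 (ij : 'I_d.+1 * 'I_d.+1) : ij \in ord_pairs d.+1 ->
    c * \sum_v (v \in VP ij.1 :|: VP ij.2)%:R * g ij.1 ij.2 v ^+ 2 <= F ij.
  case: ij => i j; rewrite inE /F /= => ij.
  have -> : \sum_(e in EP i j) stretch D x e ^+ 2 =
      2^-1 * \sum_(e in EP i j) edge_sqdiff (g i j) e.
    rewrite mulr_sumr; apply: eq_bigr => e eij.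
    have /eqP/cards2P[u [v [uv eE]]] := part_graph_simple ij eij; rewrite {}eE in eij *.
    have [s s2 Duv] := Dedge i j u v ij uv eij.
    by rewrite stretch_pair // Duv dotZr edge_sqdiff_pair // exprMn s2 dotBl.
  have -> : \sum_v (v \in VP i :|: VP j)%:R * g i j v ^+ 2 =
      \sum_(v in VP i :|: VP j) g i j v ^+ 2.
    rewrite [RHS]big_mkcond /=; apply: eq_bigr => v _.
    by case: ifP => _; rewrite ?mul1r ?mul0r.
  have := poincare (part_graph_simple ij) (fun e => rp_ends hP ij)
    (rp_connected hP ij) (hc i j ij) (constraint_mxP xC ij).
  rewrite -/(g i j) => h.
  set S := \sum_(v in _) _ in h *; set T := \sum_(e in _) _ in h *.
  by rewrite [leRHS]mulrC ler_pdivlMr // mulrAC.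
apply: le_trans (ler_sum _ step2).
rewrite -mulr_sumr ler_wpM2l // exchange_big /= sqn_field.
apply: ler_sum => v _; have [i vi] := part_of v.
rewrite (sum_pairs_part (h := fun i j => g i j v ^+ 2) _ _ vi).
- exact: X_frame.
- by move=> k l; rewrite /g -opprB dotNr sqrrN.
- by move=> k; rewrite /g subrr /dot big1 ?expr0n // => l _; rewrite !mxE mulr0.
Qed.

End RigidPartition.

(** * Curves of embeddings *)

(* [direction P(t) u v] then tends to the direction of [z] as t -> 0+. *)
Definition leading (R : realType) (V : finType) (d : nat)
    (P : V -> 'I_d -> {poly R}) (u v : V) (z : 'rV[R]_d) : Prop :=
  exists (m : nat) (g : 'I_d -> {poly R}),
    (forall k, P u k - P v k = 'X^m * g k) /\ (forall k, (g k).[0] = z 0 k).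

Section Curve.
Context (R : realType) (V : finType) (d : nat) (E : {set {set V}}).
Context (VP : 'I_d.+1 -> {set V}) (EP : 'I_d.+1 -> 'I_d.+1 -> {set {set V}}).
Hypothesis hP : rigid_partition E VP EP.
Variable X : 'I_d.+1 -> 'rV[R]_d.
Hypothesis X_inj : injective X.

(** The sign [s] accounts for the two orders of the ends of an edge. *)
Definition parallel_edges (u v : V) (z : 'rV[R]_d) : Prop :=
  forall i j : 'I_d.+1, (i < j)%N -> [set u; v] \in EP i j ->
    exists2 s, s ^+ 2 = 1 & z = s *: (X i - X j).

Definition good_curve (P : V -> 'I_d -> {poly R}) (u v : V) : Prop :=
  exists z, [/\ z != 0, leading P u v z & parallel_edges u v z].

Lemma good_curveC P u v : good_curve P u v -> good_curve P v u.
Proof.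
move=> [z [z0 [m [g [Pg g0]]] par]]; exists (- z); split.
- by rewrite oppr_eq0.
- exists m, (fun k => - g k); split=> k; first by rewrite mulrN -Pg opprB.
  by rewrite hornerN g0 mxE.
move=> i j ij; rewrite finset.setUC => /(par i j ij)[s s2 ->].
by exists (- s); rewrite ?sqrrN // scaleNr.
Qed.

(** A factor [t] raises the order of vanishing but keeps the leading direction; this passes curves
    up one level of the recursion. *)
Lemma good_curveX P Q u v : (forall k, P u k - P v k = 'X * (Q u k - Q v k)) ->
  good_curve Q u v -> good_curve P u v.
Proof.
move=> PQ [z [z0 [m [g [Qg g0]]] par]]; exists z; split=> //.
by exists m.+1, g; split=> // k; rewrite PQ Qg mulrA -exprS.
Qed.

Lemma good_curve0 (P : V -> 'I_d -> {poly R}) u v (z : 'rV_d) : z != 0 ->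
  (forall k, (P u k - P v k).[0] = z 0 k) -> parallel_edges u v z ->
  good_curve P u v.
Proof.
move=> z0 Pz par; exists z; split=> //.
by exists 0%N, (fun k => P u k - P v k); split=> // k; rewrite expr0 mul1r.
Qed.

Lemma part_edge_uniq (i j k l : 'I_d.+1) (e : {set V}) : (i < j)%N -> (k < l)%N ->
  e \in EP i j -> e \in EP k l -> i = k /\ j = l.
Proof.
move=> ij kl eij ekl; have [[-> ->]//|ne] := eqVneq (i, j) (k, l).
have /disjoint_setI0/setP/(_ e) := rp_disjoint_E hP ij kl ne.
by rewrite !inE eij ekl.
Qed.

(** Induction on [#|U|]: the two halves of a split are pulled apart along the direction of the one
    class crossing it, and their own curves are shrunk by [t]. *)
Lemma nested_curve (i0 : 'I_d.+1) (U : {set V}) : U \subset VP i0 ->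
  exists P, forall u v, u \in U -> v \in U -> u != v -> good_curve P u v.
Proof.
have [n] := ubnP #|U|; elim: n U => // n IHn U Un UV.
have [U2|U2] := leqP 2 #|U|; last first.
  exists (fun _ _ => 0) => u v uU vU uv.
  have /subset_leq_card : [set u; v] \subset U.
    by apply/fintype.subsetP => w; rewrite !inE => /orP[] /eqP ->.
  by rewrite cards2 uv leqNgt U2.
have [A [B [UAB AB A0 B0 [i [j [ij cross]]]]]] := rp_split hP UV U2.
have cardU : (#|A| + #|B| = #|U|)%N.
  by rewrite -UAB cardsU (disjoint_setI0 AB) cards0 subn0.
rewrite -card_gt0 in A0; rewrite -card_gt0 in B0.
have subA : A \subset VP i0.
  by apply: fintype.subset_trans UV; rewrite -UAB finset.subsetUl.
have subB : B \subset VP i0.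
  by apply: fintype.subset_trans UV; rewrite -UAB finset.subsetUr.
have [|P1 hP1] := IHn A _ subA; first by lia.
have [|P2 hP2] := IHn B _ subB; first by lia.
pose w := X i - X j.
have w0 : w != 0.
  by rewrite subr_eq0 (inj_eq X_inj); apply/eqP => eij; rewrite eij ltnn in ij.
(* At [t = 0] all of [A] sits at the origin and all of [B] at [w], so crossing pairs have leading
   direction [w] or [- w]. *)
pose P u k : {poly R} :=
  if u \in A then 'X * P1 u k else (w 0 k)%:P + 'X * P2 u k.
have notA u : u \in B -> (u \in A) = false.
  move=> uB; apply/negP => uA; move/disjoint_setI0/setP/(_ u): AB.
  by rewrite !inE uA uB.
have hAB u v : u \in A -> v \in B -> good_curve P u v.
  move=> uA vB; apply: (@good_curve0 _ _ _ (- w)); first by rewrite oppr_eq0.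
    move=> k; rewrite /P uA (notA v vB) !(hornerD, hornerN, hornerM, hornerX, hornerC).
    by rewrite !mul0r add0r addr0 !mxE.
  move=> k l kl uvkl; have /cross : [set u; v] \in part_edges EP.
    by apply/bigcupP; exists (k, l).
  move=> /(_ uA vB) uvij; have [<- <-] := part_edge_uniq ij kl uvij uvkl.
  by exists (- 1); rewrite ?sqrrN ?expr1n // scaleN1r.
exists P => u v; rewrite -UAB !inE => /orP[uA|uB] /orP[vA|vB] uv.
- apply: (good_curveX (Q := P1)); last exact: hP1.
  by move=> k; rewrite /P uA vA mulrBr.
- exact: hAB.
- by apply: good_curveC; exact: hAB.
- apply: (good_curveX (Q := P2)); last exact: hP2.
  by move=> k; rewrite /P !notA // mulrBr opprD addrACA subrr add0r.
Qed.

(** Vertices of different parts are apart already at [t = 0]; inside a part the nested curve, scaled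
    by [t], separates them. *)
Lemma exists_good_curve : exists P, forall u v, u != v -> good_curve P u v.
Proof.
have /choice[Ps hPs] : forall i, exists P, forall u v,
    u \in VP i -> v \in VP i -> u != v -> good_curve P u v.
  by move=> i; exact: nested_curve.
have /choice[f hf] : forall v, exists i, v \in VP i by exact: part_of hP.
pose P u k : {poly R} := (X (f u) 0 k)%:P + 'X * Ps (f u) u k.
exists P => u v uv; have [fuv|fuv] := eqVneq (f u) (f v).
  apply: (good_curveX (Q := Ps (f u))).
    by move=> k; rewrite /P -fuv mulrBr opprD addrACA subrr add0r.
  by apply: hPs => //; rewrite fuv.
apply: (@good_curve0 _ _ _ (X (f u) - X (f v))).
- by rewrite subr_eq0 (inj_eq X_inj).
- move=> k; rewrite /P !(hornerD, hornerN, hornerM, hornerX, hornerC).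
  by rewrite !mul0r !addr0 !mxE.
move=> i j ij uvij; have /fintype.subsetP sub := rp_ends hP ij uvij.
(* An edge of [E_ij] between different parts has one end in [V_i] and one in [V_j]; their order
   decides the sign. *)
have fP w : w \in [set u; v] -> f w = i \/ f w = j.
  by move/sub; rewrite inE => /orP[] wi; [left|right]; exact: (part_inj hP (hf w) wi).
have [] := fP u; first by rewrite !inE eqxx.
  move=> ui; have [] := fP v; first by rewrite !inE eqxx orbT.
    by move=> vi; rewrite ui vi eqxx in fuv.
  by move=> vj; exists 1; rewrite ?expr1n // scale1r ui vj.
move=> uj; have [] := fP v; first by rewrite !inE eqxx orbT.
  by move=> vi; exists (- 1); rewrite ?sqrrN ?expr1n // scaleN1r opprB uj vi.
by move=> vj; rewrite uj vj eqxx in fuv.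
Qed.

End Curve.

(** * Limits of directions and of stiffness matrices along a curve *)

Lemma enormE (R : realType) (d : nat) (y : 'rV[R]_d) : enorm y = Num.sqrt (sqn y).
Proof. by []. Qed.

Lemma enormZ (R : realType) (d : nat) a (y : 'rV[R]_d) :
  enorm (a *: y) = `|a| * enorm y.
Proof. by rewrite !enormE sqnZ sqrtrM ?sqr_ge0 // sqrtr_sqr. Qed.

Lemma enorm_eq0 (R : realType) (d : nat) (y : 'rV[R]_d) : (enorm y == 0) = (y == 0).
Proof. by rewrite enormE sqrtr_eq0 le_eqVlt ltNge sqn_ge0 orbF sqn_eq0. Qed.

Definition curve_at (R : realType) (V : finType) (d : nat)
    (P : V -> 'I_d -> {poly R}) (t : R) (v : V) : 'rV[R]_d :=
  \row_k (P v k).[t].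

Section Limit.
Context (R : realType) (V : finType) (d : nat).
Local Open Scope classical_set_scope.

Lemma cvg_sum_fin (I : finType) (A : pred I) (f : I -> R -> R) (a : I -> R) F :
  Filter F -> (forall i, A i -> f i t @[t --> F] --> a i) ->
  \sum_(i | A i) f i t @[t --> F] --> \sum_(i | A i) a i.
Proof. by move=> FF; apply: cvg_big; exact: add_continuous. Qed.

Lemma horner_cvg0 (p : {poly R}) : p.[t] @[t --> 0^'+] --> p.[0].
Proof. by apply: cvg_at_right_filter; exact: continuous_horner. Qed.

(** For [t > 0] the factor [t ^+ m] cancels in the normalization, and the remaining factor [G t]
    tends to [z], which is nonzero. *)
Lemma curve_direction_cvg (P : V -> 'I_d -> {poly R}) (u v : V) (z : 'rV[R]_d) :
  z != 0 -> leading P u v z ->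
  (forall k, direction (curve_at P t) u v 0 k @[t --> 0^'+] -->
     ((enorm z)^-1 *: z) 0 k) /\
  \forall t \near 0^'+, curve_at P t u != curve_at P t v.
Proof.
move=> z0 [m [g [Pg g0]]].
pose G t : 'rV[R]_d := \row_k (g k).[t].
have PG t : curve_at P t u - curve_at P t v = t ^+ m *: G t.
  by apply/rowP => k; rewrite !mxE -hornerN -hornerD Pg hornerM hornerXn.
have cG k : G t 0 k @[t --> 0^'+] --> z 0 k.
  rewrite -g0; under eq_fun do rewrite mxE; exact: horner_cvg0.
have cE : enorm (G t) @[t --> 0^'+] --> enorm z.
  apply: (@continuous_cvg _ _ _ _ _ (fun t => sqn (G t)) (@Num.sqrt R)).
    exact: sqrt_continuous.
  apply: cvg_sum_fin => k _; under eq_fun do rewrite expr2.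
  by rewrite expr2; apply: cvgM; exact: cG.
have z0' : enorm z != 0 by rewrite enorm_eq0.
split=> [k|]; last first.
  near=> t.
  have t0 : 0 < t by near: t; exact: nbhs_right_gt.
  rewrite -subr_eq0 PG scaler_eq0 expf_eq0 (gt_eqF t0) andbF /=.
  rewrite -enorm_eq0; near: t.
  have : 0 < enorm z by rewrite lt_def z0' sqrtr_ge0.
  move=> /(cvgr_gt _ cE); apply: filterS => t.
  by move/gt_eqF->.
rewrite mxE.
have h : (enorm (G t))^-1 * G t 0 k @[t --> 0^'+] --> (enorm z)^-1 * z 0 k.
  by apply: cvgM; [exact: cvgV | exact: cG].
apply: cvg_trans h; apply: near_eq_cvg; near=> t.
have t0 : 0 < t by near: t; exact: nbhs_right_gt.
have tm : t ^+ m != 0 by rewrite expf_neq0 // gt_eqF.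
rewrite /direction PG enormZ ger0_norm ?exprn_ge0 ?ltW // invfM scalerA.
by rewrite mulrAC mulVf // mul1r [RHS]mxE.
Unshelve. all: by end_near.
Qed.

(** Each [|x_i x_j|] is at most [|x|^2]; this makes entrywise convergence of matrices uniform in [x]
    for their forms. *)
Lemma qform_bound (n : nat) (A : 'M[R]_n) (x : 'rV_n) :
  `|qform A x| <= (\sum_i \sum_j `|A i j|) * sqn x.
Proof.
have -> : qform A x = \sum_i \sum_j A i j * (x 0 i * x 0 j).
  rewrite /qform mul_tr00 exchange_big /=; apply: eq_bigr => j _.
  rewrite mxE mulr_suml; apply: eq_bigr => i _; ring.
rewrite mulr_suml; apply: le_trans (ler_norm_sum _ _ _) _.
apply: ler_sum => i _; rewrite mulr_suml; apply: le_trans (ler_norm_sum _ _ _) _.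
apply: ler_sum => j _; rewrite normrM ler_wpM2l //.
have le_sqn k : x 0 k ^+ 2 <= sqn x.
  rewrite /sqn (bigD1 k) //= lerDl; apply: sumr_ge0 => l _; exact: sqr_ge0.
have := le_sqn i; have := le_sqn j; rewrite normrM.
rewrite -!(real_normK (num_real (x 0 _))).
have := sqr_ge0 (`|x 0 i| - `|x 0 j|); nra.
Qed.

(** The stiffness matrices converge entrywise, and injectivity concerns finitely many pairs, so a
    single small [t > 0] gives both conclusions. [Q] will be [parallel_edges]. *)
Lemma limit_directions (P : V -> 'I_d -> {poly R}) (E : {set {set V}})
    (Q : V -> V -> 'rV[R]_d -> Prop) :
  (forall u v, u != v -> exists z, [/\ z != 0, leading P u v z & Q u v z]) ->
  exists D : V -> V -> 'rV[R]_d,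
  [/\ forall u v, D v u = - D u v,
      forall u v, u != v -> exists z,
        [/\ z != 0, D u v = (enorm z)^-1 *: z & Q u v z] &
      forall eps, 0 < eps -> exists2 p : V -> 'rV[R]_d, injective p &
        forall x, sqn (x *m edge_mx E D) - eps * sqn x
                  <= sqn (x *m rigidity_mx E p)].
Proof.
move=> hP; pose p t := curve_at P t.
have /choice[D hD] : forall uv : V * V, exists D : 'rV[R]_d,
   (forall k, direction (p t) uv.1 uv.2 0 k @[t --> 0^'+] --> D 0 k) /\
   (uv.1 != uv.2 -> exists z, [/\ z != 0, D = (enorm z)^-1 *: z & Q uv.1 uv.2 z]).
  (* On the diagonal the direction is constantly 0, so a limit exists there too. *)
  move=> [u v] /=; have [->|uv] := eqVneq u v.
    exists 0; split=> // k; rewrite mxE.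
    under eq_fun do rewrite /direction subrr scaler0 mxE; exact: cvg_cst.
  have [z [z0 Pz Qz]] := hP u v uv.
  exists ((enorm z)^-1 *: z); split=> [|_]; first exact: (curve_direction_cvg z0 Pz).1.
  by exists z.
exists (fun u v => D (u, v)); split.
- move=> u v; apply/rowP => k.
  have h : direction (p t) v u 0 k @[t --> 0^'+] --> (- D (u, v)) 0 k.
    rewrite mxE (_ : (fun t => _) = (fun t => - direction (p t) u v 0 k)).
      by apply: cvgN; exact: (proj1 (hD (u, v)) k).
    by apply/funext => t; rewrite direction_anti mxE.
  by apply: (cvg_unique _ (proj1 (hD (v, u)) k) h); exact: Rhausdorff.
- by move=> u v uv; exact: (proj2 (hD (u, v)) uv).
move=> eps eps0.
pose A t := edge_mx E (direction (p t)).
pose A0 := edge_mx E (fun u v => D (u, v)).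
have cA r c : A t r c @[t --> 0^'+] --> A0 r c.
  have AE t : A t r c = let: (w, k) := enum_val r in
      if w \in enum_val c
      then \sum_(y in enum_val c :\ w) direction (p t) w y 0 k else 0.
    by rewrite mxE.
  rewrite (funext AE) mxE.
  case: (enum_val r) => w k /=; case: (w \in enum_val c); last exact: cvg_cst.
  by apply: cvg_sum_fin => y _; exact: (proj1 (hD (w, y)) k).
pose B t := A t *m (A t)^T - A0 *m A0^T.
have cB r s : B t r s @[t --> 0^'+] --> 0.
  have mulE (M : 'M[R]_(_, #|E|)) : (M *m M^T) r s = \sum_c M r c * M s c.
    by rewrite mxE; apply: eq_bigr => c _; rewrite mxE.
  have BE t : B t r s = \sum_c A t r c * A t s c - \sum_c A0 r c * A0 s c.
    by rewrite -!mulE mxE [X in _ + X]mxE.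
  rewrite (funext BE) -[X in _ --> X](subrr (\sum_c A0 r c * A0 s c)).
  apply: cvgB; last exact: cvg_cst.
  by apply: cvg_sum_fin => c _; apply: cvgM; exact: cA.
have cS : \sum_r \sum_s `|B t r s| @[t --> 0^'+] --> 0.
  have S0 : \sum_(r < #|{: V * 'I_d}|) \sum_(s < #|{: V * 'I_d}|) `|0 : R| = 0.
    by rewrite big1 // => r _; rewrite big1 // => s _; rewrite normr0.
  rewrite -[X in _ --> X]S0.
  by apply: cvg_sum_fin => r _; apply: cvg_sum_fin => s _; apply: cvg_norm; exact: cB.
have ev_inj : \forall t \near 0^'+,
    forall uv : V * V, uv.1 != uv.2 -> p t uv.1 != p t uv.2.
  apply: filter_forall => -[u v] /=; have [->|uv] := eqVneq u v.
    by apply: filterE => t; rewrite eqxx.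
  have [z [z0 Pz _]] := hP u v uv.
  by apply: filterS (curve_direction_cvg z0 Pz).2 => t.
have ev_le : \forall t \near 0^'+, \sum_r \sum_s `|B t r s| < eps.
  exact: cvgr_lt cS _ eps0.
have [t [t_inj t_le]] :=
  @filter_ex _ _ (at_right_proper_filter (0 : R)) _ (filterI ev_inj ev_le).
exists (p t).
  move=> u v /eqP; apply: contraTeq => uv; exact: (t_inj (u, v)).
move=> x; rewrite rigidity_edge_mx -!qform_mul_tr.
have := qform_bound (B t) x.
have -> : qform (B t) x = qform (A t *m (A t)^T) x - qform (A0 *m A0^T) x.
  by rewrite /qform mulmxBr mulmxBl mxE [X in _ + X]mxE.
rewrite ler_norml => /andP[h _].
have : (\sum_r \sum_s `|B t r s|) * sqn x <= eps * sqn x.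
  by rewrite ler_wpM2r ?sqn_ge0 // ltW.
by rewrite -/A0 -/(A t); lra.
Qed.

End Limit.

(** * The eigenvalue bound and rigidity *)

Lemma rank_ge_codim (F : fieldType) (n m k : nat)
    (M : 'M[F]_(n, m)) (C : 'M[F]_(n, k)) :
  (forall x : 'rV_n, x *m M = 0 -> x *m C = 0 -> x = 0) -> (n - k <= \rank M)%N.
Proof.
(* The left kernels meet trivially, so [(n - \rank M) + (n - \rank C) <= n], where
   [\rank C <= k]. *)
move=> MC0; have capK : (kermx M :&: kermx C)%MS = 0.
  apply/eqP; rewrite -submx0; apply/rV_subP => x.
  rewrite sub_capmx => /andP[/sub_kermxP xM /sub_kermxP xC].
  by rewrite (MC0 x) // submx0.
have := mxrank_sum_cap (kermx M) (kermx C).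
have := rank_leq_col (kermx M + kermx C)%MS; have := rank_leq_col C.
by rewrite capK mxrank0 !mxrank_ker; lia.
Qed.

Section Main.
Context (R : realType) (V : finType) (d : nat) (E : {set {set V}}).
Context (VP : 'I_d.+1 -> {set V}) (EP : 'I_d.+1 -> 'I_d.+1 -> {set {set V}}).
Hypotheses (hd : (1 <= d)%N) (hV : (d.+1 <= #|V|)%N).
Hypotheses (hE : simple_graph E) (hP : rigid_partition E VP EP).

(** [X] is fixed before [eps], so one constraint subspace serves all the embeddings along the
    curve. *)
Lemma near_extremal (c : R) : 0 <= c ->
  (forall i j : 'I_d.+1, (i < j)%N ->
     ((c * 2)%:E <= alg_connectivity R (VP i :|: VP j) (EP i j))%E) ->
  exists X : 'I_d.+1 -> 'rV[R]_d, forall eps, 0 < eps ->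
    exists2 p : V -> 'rV[R]_d, injective p &
    forall x, x *m constraint_mx VP X = 0 ->
      (c - eps) * sqn x <= sqn (x *m rigidity_mx E p).
Proof.
move=> c0 hc; have [X [X2 Xframe]] := regular_simplex R d; exists X.
have Xinj : injective X.
  move=> i j Xij; apply/eqP; apply: contraT => /X2 /eqP.
  by rewrite Xij subrr sqnE mul0mx mxE eq_sym pnatr_eq0.
have [P goodP] := exists_good_curve hP Xinj.
have [D [Danti Dpar Dlim]] := limit_directions E goodP.
have sqrt2 : (Num.sqrt 2 : R)^-1 ^+ 2 = 2^-1 by rewrite exprVn sqr_sqrtr.
have lim_ge := limit_form_ge hE hP Xframe Danti _ c0 hc.
move=> eps /Dlim[p pinj hp]; exists p => // x xC.
rewrite mulrBl; apply: le_trans (hp x); rewrite lerD2r; apply: lim_ge => //.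
move=> i j u v ij uv uvij; have [z [z0 -> /(_ i j ij uvij)[s s2 ez]]] := Dpar u v uv.
have ij' : i != j by rewrite neq_ltn ij.
(* [z] is a simplex edge up to sign, of length [sqrt 2]; normalizing it produces the [s ^+ 2 = 2^-1]
   of the limit form. *)
have e2 : enorm z = Num.sqrt 2 by rewrite enormE ez sqnZ s2 mul1r X2.
exists ((Num.sqrt 2)^-1 * s); first by rewrite exprMn sqrt2 s2 mulr1.
by rewrite e2 {1}ez scalerA.
Qed.

(** Guarantees that the eigenvalue of index [('C(d.+1, 2)).+1] exists and is not the default of
    [nth]. *)
Lemma card_pairs_lt : ('C(d.+1, 2) < d * #|V|)%N.
Proof.
have : (d * d.+1 <= d * #|V|)%N by rewrite leq_mul2l hV orbT.
by rewrite bin2 /= mulnC; nia.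
Qed.

(** Positive since every [G_ij] is connected; finite since two distinct vertices lie in a common
    [V_i u V_j], where the one-vertex convention does not apply. *)
Lemma min_connectivity_fin :
  exists2 c : R, 0 < c &
    \big[Order.min/+oo%E]_(ij : 'I_d.+1 * 'I_d.+1 | (ij.1 < ij.2)%N)
      (alg_connectivity R (VP ij.1 :|: VP ij.2) (EP ij.1 ij.2) * (2^-1)%:E)%E
    = c%:E.
Proof.
set m := \big[_/_]_(_ | _) _.
have m0 : (0 < m)%E.
  apply: lt_bigmin => // -[i j] /= ij; apply: mule_gt0.
    exact: alg_connectivity_gt0 (part_graph_simple hE hP ij)
      (fun e => rp_ends hP ij) (rp_connected hP ij).
  by rewrite lte_fin invr_gt0.
have moo : (m < +oo)%E.
  have V2 : (1 < #|[set: V]|)%N by rewrite cardsT; lia.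
  have [u [v [_ _ uv]]] := card_gt1P V2.
  have [i ui] := part_of hP u; have [j vj] := part_of hP v.
  have [k [l [kl uk vl]]] : exists k l : 'I_d.+1,
      [/\ (k < l)%N, u \in VP k :|: VP l & v \in VP k :|: VP l].
    have pick (a b : 'I_d.+1) : a != b -> u \in VP a :|: VP b -> v \in VP a :|: VP b ->
        exists k l : 'I_d.+1, [/\ (k < l)%N, u \in VP k :|: VP l & v \in VP k :|: VP l].
      rewrite neq_ltn => /orP[ab|ba] ua va; first by exists a, b.
      by exists b, a; rewrite finset.setUC.
    (* If both vertices lie in one part, it is paired with any other index, which exists as
       [1 <= d]. *)
    have [ij|ij] := eqVneq i j; last by apply: (pick i j ij); rewrite inE ?ui ?vj ?orbT.
    have [b ib] : exists b, i != b.
      exists (if i == ord0 then ord_max else ord0).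
      have [->|//] := eqVneq i ord0; rewrite -val_eqE /=; lia.
    by apply: (pick i b ib); rewrite inE ?ui // ij vj.
  pose a (ij : 'I_d.+1 * 'I_d.+1) :=
    (alg_connectivity R (VP ij.1 :|: VP ij.2) (EP ij.1 ij.2) * (2^-1)%:E)%E.
  apply: (@le_lt_trans _ _ (a (k, l))).
    exact: (bigmin_le_cond _ a (j := (k, l)) kl).
  rewrite /a /alg_connectivity.
  case: eqP => [/eqP/cards1P[w wE]|_]; last by rewrite -EFinM ltry.
  by move: uk vl uv; rewrite wE !inE => /eqP -> /eqP ->; rewrite eqxx.
exists (fine m); first by rewrite -lte_fin fineK // gt0_fin_numE.
by rewrite fineK // gt0_fin_numE.
Qed.

End Main.

Theorem theorem2p1 (R : realType) (V : finType) (d : nat)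
    (E : {set {set V}})
    (VP : 'I_d.+1 -> {set V}) (EP : 'I_d.+1 -> 'I_d.+1 -> {set {set V}})
    (hd : (1 <= d)%N) (hV : (d.+1 <= #|V|)%N)
    (hE : simple_graph E) (hP : rigid_partition E VP EP) :
  (\big[Order.min/+oo]_(ij : 'I_d.+1 * 'I_d.+1 | (ij.1 < ij.2)%N)
     (alg_connectivity R (VP ij.1 :|: VP ij.2) (EP ij.1 ij.2) * (2^-1)%:E)
   <= alg_connectivity_dim R d E)%E
  /\ d_rigid R d E.
Proof.
have [c c0 minE] := @min_connectivity_fin R V d E VP EP hd hV hE hP.
have hc (i j : 'I_d.+1) : (i < j)%N ->
    ((c * 2)%:E <= alg_connectivity R (VP i :|: VP j) (EP i j))%E.
  move=> ij; rewrite EFinM -lee_pdivlMr // -minE.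
  exact: (bigmin_le_cond _ (fun ij : 'I_d.+1 * 'I_d.+1 =>
    (alg_connectivity R (VP ij.1 :|: VP ij.2) (EP ij.1 ij.2) * (2^-1)%:E)%E)
    (j := (i, j)) ij).
have [X hX] := near_extremal hE hP (ltW c0) hc.
have NE : #|{: V * 'I_d}| = (d * #|V|)%N by rewrite card_prod card_ord mulnC.
have kN := card_pairs_lt hd hV.
split.
  (* The placement at [t = 0] collapses each part to a point, so embeddings reach [c] only up to
     [eps]. *)
  rewrite minE; apply/lee_addgt0Pr => eps eps0.
  have [p pinj hp] := hX eps eps0.
  pose lam := lambda ('C(d.+1, 2)).+1 (stiffness_mx E p).
  apply: le_trans (_ : (lam%:E + eps%:E <= _)%E); last first.
    by rewrite leeD2r //; apply: ereal_sup_ubound; exists p.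
  rewrite -EFinD lee_fin -lerBlDr.
  (* With ['C(d.+1, 2)] constraint columns, [lambda_ge] bounds precisely the eigenvalue in [lam]. *)
  move: (constraint_mx VP X) hp; rewrite card_ord_pairs => C hp.
  apply: (lambda_ge (C := C)); last by move=> x xC; rewrite qform_mul_tr; exact: hp.
    by rewrite /stiffness_mx trmx_mul trmxK.
  by rewrite NE.
(* Any [eps] below [c] keeps the form positive definite on the constrained fields, so none of them
   but 0 is annihilated by the rigidity matrix. *)
have [p pinj hp] := hX (c / 2) (divr_gt0 c0 (ltr0n _ 2)).
exists p => //; apply/eqP; rewrite eqn_leq rank_rigidity_mx //=.
set C := constraint_mx VP X in hp *; set M := rigidity_mx E p in hp *.
apply: leq_trans (_ : #|{: V * 'I_d}| - #|ord_pairs d.+1| <= _)%N.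
  by rewrite NE card_ord_pairs.
apply: (rank_ge_codim (C := C)) => x xM xC.
have := hp x xC; rewrite xM [sqn 0]sqnE mul0mx mxE.
rewrite pmulr_rle0; last by lra.
by have := sqn_ge0 x => h1 h2; apply/eqP; rewrite -sqn_eq0; apply/eqP/le_anti/andP.
Qed.
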